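(* Let $G$ be a graph on $n$ vertices. Let $I=J(\widetilde G)$ be the cover ideal of the whiskering $\widetilde G$ of $G$. Then $I$ is Freiman if and only if $G$ is almost complete.
   Context: All graphs are finite and simple. Given a graph $G$ with vertices $x_1,\dots,x_n$, its whiskering $\widetilde G$ is the graph with vertex set $\{x_1,\dots,x_n,y_1,\dots,y_n\}$ and edge set $E(G)\cup\{\{x_i,y_i\}: i=1,\dots,n\}$. A graph with $N$ vertices is almost complete if it has an induced complete subgraph on $N-1$ vertices (so complete graphs are almost complete). Vertices are identified with variables of a polynomial ring $R$ over a field $k$; the cover ideal of a graph $H$ is $J(H)=\bigcap_{\{u,v\}\in E(H)}(u,v)\subseteq R$. A monomial ideal $I$ of $R=k[z_1,\dots,z_N]$ with minimal monomial generators $f_1,\dots,f_t$, $f_j=\prod_i z_i^{c_{ij}}$, is quasi-equigenerated if there are positive integers $a_1,\dots,a_N$ such that $\sum_i a_i c_{ij}$ is the same for all $j$. The fiber cone is $F(I)=\bigoplus_{i\ge0}I^i/\mathfrak m I^i$ with $\mathfrak m$ the homogeneous maximal ideal; the analytic spread $l(I)$ is the Krull dimension of $F(I)$; $\mu(\cdot)$ is the minimal number of generators. A quasi-equigenerated monomial ideal $I$ is Freiman if $\mu(I^2)=l(I)\mu(I)-\binom{l(I)}{2}$. *)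

(* Defs.v *)
(* MathComp, with multinomials for polynomial rings and boolp for classical logic. *)
From HB Require Import structures.
From mathcomp Require Import all_boot all_order all_algebra.
From mathcomp Require Import boolp.
From mathcomp Require Import mpoly.

Set Implicit Arguments.
Unset Strict Implicit.
Unset Printing Implicit Defensive.

Import GRing.Theory.
Local Open Scope ring_scope.

Record sgraph (n : nat) := SGraph {
  adj :> rel 'I_n;
  adj_sym : ssrbool.symmetric adj;
  adj_irr : irreflexive adj
}.

(* For n = 0 the truncated n.-1 is 0, so that the empty graph, being complete,
   is almost complete. *)
Definition almost_complete (n : nat) (G : sgraph n) : Prop :=
  exists S : {set 'I_n},
    #|S| = n.-1 /\ {in S &, forall u v, u != v -> G u v}.

(* The vertex x_i is lshift n i and the vertex y_i is rshift n i. *)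
Definition whisker_adj (n : nat) (G : sgraph n) : rel 'I_(n + n) :=
  fun u v =>
    match split u, split v with
    | inl i, inl j => G i j
    | inl i, inr j => i == j
    | inr i, inl j => i == j
    | inr _, inr _ => false
    end.

Lemma whisker_sym (n : nat) (G : sgraph n) : ssrbool.symmetric (whisker_adj G).
Proof.
move=> u v; rewrite /whisker_adj.
by case: (split u) => i; case: (split v) => j //; exact: adj_sym || exact: eq_sym.
Qed.

Lemma whisker_irr (n : nat) (G : sgraph n) : irreflexive (whisker_adj G).
Proof.
by move=> u; rewrite /whisker_adj; case: (split u) => i //; rewrite adj_irr.
Qed.

Definition whiskering (n : nat) (G : sgraph n) : sgraph (n + n) :=
  SGraph (whisker_sym G) (whisker_irr G).

(* Ideals are boolean predicates, made decidable by [`[< _ >]]; unlike the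
   library's [idealr_closed], they may contain 1. *)

Section Ideals.
Variable A : comNzRingType.

Definition ideal_gen (S : {pred A}) : {pred A} := fun p =>
  `[< exists (r : nat) (c s : 'I_r -> A),
        (forall i, s i \in S) /\ p = \sum_(i < r) c i * s i >].

Definition ideal_mul (I J : {pred A}) : {pred A} :=
  ideal_gen (fun p => `[< exists a b, [/\ a \in I, b \in J & p = a * b] >]).

Definition ideal_exp (I : {pred A}) (i : nat) : {pred A} :=
  iter i (ideal_mul I) predT.

Definition min_num_gens (I : {pred A}) (r : nat) : Prop :=
  (exists t : r.-tuple A, I =i ideal_gen (mem t)) /\
  (forall (r' : nat) (t : r'.-tuple A), I =i ideal_gen (mem t) -> (r <= r')%N).

(* [idealr_closed] includes properness. *)
Definition prime_ideal (P : {pred A}) : Prop :=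
  idealr_closed P /\ prime_idealr_closed P.

Definition prime_chain (d : nat) (P : 'I_d.+1 -> {pred A}) : Prop :=
  (forall i, prime_ideal (P i)) /\
  (forall i j : 'I_d.+1, (i < j)%N ->
     {subset P i <= P j} /\ ~ {subset P j <= P i}).

Definition krull_dim (d : nat) : Prop :=
  (exists P : 'I_d.+1 -> {pred A}, prime_chain P) /\
  (forall (e : nat) (P : 'I_e.+1 -> {pred A}), prime_chain P -> (e <= d)%N).

Lemma ideal_gen_in (S : {pred A}) p : p \in S -> p \in ideal_gen S.
Proof.
move=> Sp; apply/asboolP; exists 1%N, (fun=> 1), (fun=> p).
by split=> //; rewrite big_ord1 mul1r.
Qed.

Lemma ideal_gen0 (S : {pred A}) : 0 \in ideal_gen S.
Proof.
apply/asboolP; exists 0%N, (fun=> 0), (fun=> 0).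
by split=> [[]|] //; rewrite big_ord0.
Qed.

Lemma ideal_genD (S : {pred A}) p q :
  p \in ideal_gen S -> q \in ideal_gen S -> p + q \in ideal_gen S.
Proof.
move=> /asboolP[r [c [s [Ss ->]]]] /asboolP[r' [c' [s' [Ss' ->]]]].
apply/asboolP; exists (r + r')%N.
exists (fun i => match split i with inl j => c j | inr j => c' j end).
exists (fun i => match split i with inl j => s j | inr j => s' j end).
split=> [i|]; first by case: (split i) => j.
rewrite big_split_ord; congr (_ + _); apply: eq_bigr => i _.
  by rewrite (unsplitK (inl i)).
by rewrite (unsplitK (inr i)).
Qed.

Lemma ideal_genM (S : {pred A}) a p :
  p \in ideal_gen S -> a * p \in ideal_gen S.
Proof.
move=> /asboolP[r [c [s [Ss ->]]]].
apply/asboolP; exists r, (fun i => a * c i), s; split=> //.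
by rewrite mulr_sumr; apply: eq_bigr => i _; rewrite mulrA.
Qed.

Lemma ideal_gen_ind (S : {pred A}) (P : A -> Prop) :
  P 0 -> (forall p q, P p -> P q -> P (p + q)) ->
  (forall c s, s \in S -> P (c * s)) -> forall p, p \in ideal_gen S -> P p.
Proof.
by move=> P0 PD PM p /asboolP[r [c [s [Ss ->]]]]; apply: big_ind => // i _; apply: PM.
Qed.

Lemma ideal_mul_in (I J : {pred A}) a b :
  a \in I -> b \in J -> a * b \in ideal_mul I J.
Proof. by move=> Ia Jb; apply/ideal_gen_in/asboolP; exists a, b. Qed.

Lemma ideal_exp_closed (I : {pred A}) i :
  [/\ 0 \in ideal_exp I i,
      (forall p q, p \in ideal_exp I i -> q \in ideal_exp I i ->
         p + q \in ideal_exp I i) &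
      (forall a p, p \in ideal_exp I i -> a * p \in ideal_exp I i)].
Proof.
case: i => [|i] /=; first by split.
split; first exact: ideal_gen0.
  by move=> p q; apply: ideal_genD.
by move=> a p; apply: ideal_genM.
Qed.

Lemma ideal_expM (I : {pred A}) i j p q :
  p \in ideal_exp I i -> q \in ideal_exp I j -> p * q \in ideal_exp I (i + j).
Proof.
elim: i p q => [|i IHi] p q.
  by move=> _ Iq; have [_ _] := ideal_exp_closed I j; apply.
move=> Ip Iq; rewrite addSn; have [I0 ID IM] := ideal_exp_closed I (i + j).+1.
move: p Ip; apply: ideal_gen_ind => [|p p' Hp Hp'|c s /asboolP[a [b [Ia Ib ->]]]].
- by rewrite mul0r.
- by rewrite mulrDl ID.
- rewrite -!mulrA; apply: IM; apply: ideal_mul_in => //; exact: IHi.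
Qed.

End Ideals.

Section PolynomialRing.
Variables (k : fieldType) (N : nat).
Local Notation R := {mpoly k[N]}.

Definition cover_ideal (H : sgraph N) : {pred R} := fun p =>
  `[< forall u v : 'I_N, H u v -> p \in ideal_gen (pred2 'X_u 'X_v) >].

Definition monomial_ideal (I : {pred R}) : Prop :=
  I =i ideal_gen (fun p => `[< exists2 m : 'X_{1..N}, p = 'X_[m] & p \in I >]).

(* [(m' <= m)%MM] is divisibility of monomials. *)
Definition min_mon_gen (I : {pred R}) (m : 'X_{1..N}) : Prop :=
  'X_[m] \in I /\
  (forall m' : 'X_{1..N}, 'X_[m'] \in I -> (m' <= m)%MM -> m' = m).

Definition quasi_equigenerated (I : {pred R}) : Prop :=
  monomial_ideal I /\
  exists a : 'I_N -> nat, (forall i, (0 < a i)%N) /\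
    forall m m', min_mon_gen I m -> min_mon_gen I m' ->
      (\sum_(i < N) a i * m i = \sum_(i < N) a i * m' i)%N.

Definition homog_max_ideal : {pred R} :=
  ideal_gen [pred p | [exists i, p == 'X_i]].

Section FiberCone.
Variable I : {pred R}.

(* The fiber cone, the direct sum of the I^i / m I^i with the product
   (a + m I^i) (b + m I^j) = ab + m I^(i+j), is realized as the quotient of the
   Rees algebra, i.e. of the polynomials p over R with p`_i in I^i for all i,
   by the ideal of those p with p`_i in m I^i for all i. *)
Definition in_rees : {pred {poly R}} := fun p =>
  `[< forall i : nat, p`_i \in ideal_exp I i >].

Lemma in_rees_subring : subring_closed in_rees.
Proof.
split.
- apply/asboolP => i; rewrite coef1; case: i => // i.
  by have [] := ideal_exp_closed I i.+1.
- move=> p q /asboolP Ip /asboolP Iq; apply/asboolP => i.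
  have [I0 ID IM] := ideal_exp_closed I i.
  by rewrite coefB -mulN1r ID ?IM.
- move=> p q /asboolP Ip /asboolP Iq; apply/asboolP => i.
  have [I0 ID IM] := ideal_exp_closed I i.
  rewrite coefM; apply: (big_ind (fun x => x \in ideal_exp I i)) => // j _.
  by have := ideal_expM (Ip j) (Iq (i - j)%N); rewrite subnKC // -ltnS.
Qed.

HB.instance Definition _ :=
  GRing.isSubringClosed.Build {poly R} in_rees in_rees_subring.

Record rees_algebra := Rees { rees_val : {poly R}; _ : rees_val \in in_rees }.

HB.instance Definition _ := [isSub for rees_val].
HB.instance Definition _ := [Choice of rees_algebra by <:].
HB.instance Definition _ :=
  [SubChoice_isSubComNzRing of rees_algebra by <:].

Definition fiber_ideal : {pred rees_algebra} := fun p =>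
  `[< forall i : nat,
        (val p)`_i \in ideal_mul homog_max_ideal (ideal_exp I i) >].

Lemma homog_max_ideal0 p : p \in homog_max_ideal -> p@_0%MM = 0.
Proof.
move: p; apply: ideal_gen_ind => [|p q Hp Hq|c s].
- by rewrite mcoeff0.
- by rewrite mcoeffD Hp Hq addr0.
- move=> /existsP[i /eqP ->]; rewrite rmorphM /=.
  by rewrite mcoeffX mnm1_eq0 mulr0.
Qed.

Lemma max_ideal_expM i j x y :
  x \in ideal_exp I i -> y \in ideal_mul homog_max_ideal (ideal_exp I j) ->
  x * y \in ideal_mul homog_max_ideal (ideal_exp I (i + j)).
Proof.
move=> Hx; move: y.
apply: ideal_gen_ind => [|y y' Hy Hy'|c s /asboolP[m [b [Mm Ib ->]]]].
- by rewrite mulr0 ideal_gen0.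
- by rewrite mulrDr ideal_genD.
- rewrite mulrCA [x * _]mulrCA.
  by apply: ideal_genM; apply: ideal_mul_in => //; apply: ideal_expM.
Qed.

Lemma fiber_ideal_closed : idealr_closed fiber_ideal.
Proof.
split.
- by apply/asboolP => i; rewrite raddf0 coef0 ideal_gen0.
- apply/asboolP => /(_ 0%N); rewrite rmorph1 coef1 /= => H.
  suff: (1 : R)@_0%MM = 0 by rewrite mcoeff1 eqxx => /eqP; rewrite oner_eq0.
  move: (1 : R) H; apply: ideal_gen_ind => [|p q Hp Hq|c s].
  + by rewrite mcoeff0.
  + by rewrite mcoeffD Hp Hq addr0.
  + move=> /asboolP[a [b [/(ideal_genM (c * b)) Ma _ ->]]].
    by apply: homog_max_ideal0; rewrite [a * b]mulrC mulrA.
- move=> a u v /asboolP Hu /asboolP Hv; apply/asboolP => i.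
  rewrite rmorphD rmorphM coefD; apply: ideal_genD => //.
  pose J := ideal_mul homog_max_ideal (ideal_exp I i).
  change ((val a * val u)`_i \in J); rewrite coefM.
  apply: (big_ind (fun x => x \in J)) => [||j _]; first exact: ideal_gen0.
    by move=> x y; apply: ideal_genD.
  have /asboolP/(_ (nat_of_ord j)) Ha := valP a.
  have := max_ideal_expM Ha (Hu (i - j)%N).
  by rewrite subnKC // -ltnS.
Qed.

HB.instance Definition _ :=
  isIdealr.Build rees_algebra fiber_ideal fiber_ideal_closed.

Definition fiber_cone : comNzRingType := {ideal_quot fiber_ideal}.

Definition analytic_spread (l : nat) : Prop := krull_dim fiber_cone l.

End FiberCone.

Definition freiman (I : {pred R}) : Prop :=
  quasi_equigenerated I /\
  exists mu mu2 l : nat,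
    [/\ min_num_gens I mu, min_num_gens (ideal_exp I 2) mu2,
        analytic_spread I l &
        mu2%:Z = l%:Z * mu%:Z - 'C(l, 2)%:Z].

End PolynomialRing.

Arguments cover_ideal k {N} H.

(* Main.v *)
(* A minimal vertex cover of the whiskering picks x_i or y_i for every i, and the
   set A of indices where it picks y_i is an arbitrary independent set of G.  So
   mu(I) is the number of independent sets, and mu(I^2) is the number of sums of
   two indicator vectors of independent sets.  The fiber cone embeds into
   k[z_1, ..., z_n, T], the generator of A going to T * prod_(i in A) z_i; it
   contains T and all T z_i, hence has dimension n + 1.  The upper bound is a
   count: d + 1 polynomials in d variables are algebraically dependent, whereas
   elements x_i in P_i.+1 but not in P_i along a chain of primes are not.

   The theorem becomes a statement on the simplicial complex S of independent
   sets: the number of sums is at least (n + 1) |S| - C(n + 1, 2).  Every face A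
   is charged |A| + 1 times to the support A and once to each A + i, i not in A,
   which is n + 1 charges in all.  On each support U the charges exceed the
   number of sums at most by one, and only if |U| is 1 or 2.  Equality holds
   everywhere iff the non-edges of G form a star. *)
Require Import Defs.
From HB Require Import structures.
From mathcomp Require Import all_boot all_order all_algebra.
From mathcomp Require Import boolp zify.
From mathcomp Require Import mpoly.

Set Implicit Arguments.
Unset Strict Implicit.
Unset Printing Implicit Defensive.

Import GRing.Theory.

(** * Sums of two faces of a simplicial complex *)

Section SumsOfFaces.
Variables (T : finType) (S : {set {set T}}).
Hypothesis S_down : forall A B : {set T}, B \subset A -> A \in S -> B \in S.
Hypothesis S_set0 : set0 \in S.
Hypothesis S_set1 : forall i, [set i] \in S.

(* The pair (A :|: B, A :&: B) encodes the sum of the indicator vectors. *)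
Definition face_sums : {set {set T} * {set T}} :=
  [set (A :|: B, A :&: B) | A in S, B in S].

Definition face_sums_over (U : {set T}) : {set {set T}} :=
  [set D | (U, D) \in face_sums].

Definition cofaces (U : {set T}) : {set T} := [set i in U | U :\ i \in S].

(** The first term is what a face gives to its own support. The elements of [cofaces U] stand for
    the faces with one point less, each of which gives one unit to [U]. *)
Definition charge (U : {set T}) : nat :=
  (U \in S) * #|U|.+1 + #|cofaces U|.

Lemma card_face_sums : #|face_sums| = \sum_(U : {set T}) #|face_sums_over U|.
Proof.
under eq_bigr => U _ do rewrite -sum1_card big_mkcond.
rewrite pair_big -sum1_card big_mkcond /=.
by apply: eq_bigr => -[U D] _; rewrite inE.
Qed.

(** Counted by giver instead of receiver, a face [A] gives [#|A|.+1] to itself and one unit to each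
    of the [#|~: A|] sets obtained by adding a point. *)
Lemma sum_charge : \sum_(U : {set T}) charge U = #|T|.+1 * #|S|.
Proof.
rewrite big_split /=.
have -> : \sum_(U : {set T}) (U \in S) * #|U|.+1 = \sum_(U in S) #|U|.+1.
  by rewrite [RHS]big_mkcond; apply: eq_bigr => U _; case: (_ \in _); rewrite ?mul1n.
have -> : \sum_(U : {set T}) #|cofaces U| = \sum_(U in S) #|~: U|.
  under [LHS]eq_bigr => U _ do rewrite -sum1_card.
  under [RHS]eq_bigr => U _ do rewrite -sum1_card.
  rewrite (exchange_big_dep predT) //= [RHS](exchange_big_dep predT) //=.
  apply: eq_bigr => i _.
  (* The sets having [i] among their cofaces are the [i |: A] for the faces [A] that avoid [i]. *)
  rewrite (reindex_onto (fun A => i |: A) (fun A => A :\ i)) /=; last first.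
    by move=> A; rewrite inE => /andP[iA _]; rewrite setD1K.
  apply: eq_bigl => A; rewrite inE setU11 /= in_setC.
  have [iA|iA] := boolP (i \in A); last by rewrite setU1K // eqxx !andbT.
  rewrite !andbF; apply/negP => /andP[_ /eqP e].
  by move: iA; rewrite -e !inE eqxx.
rewrite -big_split /= mulnC -sum_nat_const; apply: eq_bigr => A _.
by rewrite addSn cardsC.
Qed.

(** Pascal's rule turns the binomial correction into one unit of slack for each support of size 1 or
    2. *)
Lemma sum_card12 : \sum_(U : {set T}) (#|U| \in [:: 1; 2]) = 'C(#|T|.+1, 2).
Proof.
have card_sum k : \sum_(U : {set T}) (#|U| == k) = 'C(#|T|, k).
  by rewrite -card_draws -sum1_card [RHS]big_mkcond; apply: eq_bigr => U _;
     rewrite inE; case: eqP.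
rewrite binS -!card_sum -big_split; apply: eq_bigr => U _.
by rewrite !inE; case: eqP => [->|_]; case: eqP.
Qed.

Lemma cofaces_face U : U \in S -> cofaces U = U.
Proof.
move=> SU; apply/setP => i; rewrite inE (S_down _ SU) ?andbT //.
exact: subsetDl.
Qed.

Lemma charge_face U : U \in S -> charge U = (#|U|.*2).+1.
Proof. by move=> SU; rewrite /charge SU mul1n cofaces_face // addSn addnn. Qed.

Lemma charge_nonface U : U \notin S -> charge U = #|cofaces U|.
Proof. by move=> /negbTE SU; rewrite /charge SU. Qed.

Lemma card_nonface U : U \notin S -> 1 < #|U|.
Proof.
apply: contraR; rewrite -leqNgt => /card_le1P U1.
have [->//|[x xU]] := set_0Vmem U.
suff -> : U = [set x] by [].
by apply/setP => y; rewrite (U1 x xU) !inE.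
Qed.

(** Every subset [D] of the face [U] is itself a face, and the pair [U], [D] has union [U] and
    intersection [D]. *)
Lemma face_sums_over_face U : U \in S -> #|face_sums_over U| = 2 ^ #|U|.
Proof.
move=> SU; rewrite -card_powerset; apply: eq_card => D; rewrite !inE.
apply/imset2P/idP => [[A B SA SB [-> ->]]|DU].
  by rewrite (subset_trans (subsetIl _ _)) ?subsetUl.
exists U D => //; first exact: S_down DU SU.
by rewrite (setUidPl DU) (setIidPr DU).
Qed.

Lemma face_sums_over0 (U : {set T}) i : i \in cofaces U -> set0 \in face_sums_over U.
Proof.
rewrite !inE => /andP[iU SUi]; apply/imset2P; exists (U :\ i) [set i] => //.
rewrite setUC setD1K //; congr (_, _); apply/setP => x; rewrite !inE.
by case: (x == i); rewrite ?andbF.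
Qed.

(** For two cofaces [i] and [j] other than [k], take the faces [U :\ i] and [[set i; k]]; the latter
    is a face because it lies in [U :\ j]. *)
Lemma face_sums_over1 (U : {set T}) k :
  k \in U -> 1 < #|cofaces U :\ k| -> [set k] \in face_sums_over U.
Proof.
move=> kU /card_gt1P[i [j []]]; rewrite !inE => /and3P[ik iU Si] /and3P[jk jU Sj] ij.
apply/imset2P; exists (U :\ i) [set i; k] => //.
  apply: S_down Sj; apply/subsetP => x; rewrite !inE.
  by case/pred2P=> ->; rewrite eq_sym ?jk // eq_sym ?ij ?iU // eq_sym jk.
congr (_, _); apply/setP => x; rewrite !inE.
  have [->|xi] := eqVneq x i; first by rewrite iU.
  by have [->|xk] := eqVneq x k; rewrite ?kU ?orbF.
have [->|xk] := eqVneq x k; first by rewrite eq_sym ik kU orbT.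
by rewrite orbF; case: eqP; rewrite ?andbF.
Qed.

Lemma expn2_gt u : 2 < u -> (u.*2).+1 < 2 ^ u.
Proof.
case: u => [|[|[|u]]] // _; elim: u => // u IHu.
by rewrite [X in _ < X]expnS; lia.
Qed.

(** For a face of size u the comparison is 2 u + 1 against 2 ^ u, short by one exactly at u = 1 and
    u = 2. For a larger nonface, enough sums are found among those whose intersection is empty or a
    single point. *)
Lemma charge_le U : charge U <= #|face_sums_over U| + (#|U| \in [:: 1; 2]).
Proof.
have [SU|SU] := boolP (U \in S).
  rewrite charge_face // face_sums_over_face //.
  have [|U2] := ltnP 2 #|U|; first by move/expn2_gt/ltnW/leq_trans; apply; rewrite leq_addr.
  by case: #|U| U2 => [|[|[|]]].
rewrite charge_nonface //.
have [->|[i iP]] := set_0Vmem (cofaces U); first by rewrite cards0.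
have h0 := face_sums_over0 iP.
have h1 : 0 < #|face_sums_over U| by apply/card_gt0P; exists set0.
have PU : cofaces U \subset U by apply/subsetP => x; rewrite inE => /andP[].
have U2 := card_nonface SU.
have [U2'|nU2] := eqVneq #|U| 2.
  apply: leq_trans (subset_leq_card PU) _.
  by rewrite U2' (leq_add2r 1 1).
have {nU2}U2 : 2 < #|U| by rewrite ltn_neqAle eq_sym nU2.
apply: leq_trans (leq_addr _ _).
have [r1|r2] := leqP #|cofaces U| 1; first exact: leq_trans r1 h1.
(* The points [k] for which [face_sums_over1] yields the intersection [[set k]]; the empty
   intersection comes on top of these. *)
pose Q := [set k in U | 1 < #|cofaces U :\ k|].
have hQ : #|Q| < #|face_sums_over U|.
  rewrite (cardsD1 set0) h0 ltnS -(card_imset (mem Q) (@set1_inj T)).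
  apply: subset_leq_card; apply/subsetP => _ /imsetP[x + ->].
  rewrite inE => /andP[xU xP]; rewrite in_setD1 face_sums_over1 // andbT.
  by apply/eqP => /setP/(_ x); rewrite !inE eqxx.
(* With three or more cofaces every point of [U] is in [Q]. With exactly two, [Q] contains each
   point of [U] that is not a coface, and there is one since [U] has at least three points. *)
apply: leq_trans hQ; have [r3|r3] := ltnP 2 #|cofaces U|.
  apply: leqW; apply/subset_leq_card/(subset_trans PU)/subsetP => x xU.
  by rewrite inE xU -ltnS (leq_trans r3) // (cardsD1 x) -add1n leq_add2r leq_b1.
have /eqP e2 : #|cofaces U| == 2 by rewrite eqn_leq r3.
rewrite e2 ltnS card_gt0.
have /set0Pn[x] : U :\: cofaces U != set0.
  by rewrite -card_gt0 cardsD (setIidPr PU) e2 subn_gt0.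
rewrite inE => /andP[xP xU]; apply/set0Pn; exists x.
by rewrite inE xU; move: e2; rewrite (cardsD1 x) (negbTE xP) add0n => ->.
Qed.

Lemma face_sums_lower : #|T|.+1 * #|S| <= #|face_sums| + 'C(#|T|.+1, 2).
Proof.
rewrite -sum_charge card_face_sums -sum_card12 -big_split /=.
by apply: leq_sum => U _; apply: charge_le.
Qed.

Lemma face_sums_lower_strict U :
  charge U < #|face_sums_over U| + (#|U| \in [:: 1; 2]) ->
  #|T|.+1 * #|S| < #|face_sums| + 'C(#|T|.+1, 2).
Proof.
move=> ltU; rewrite -sum_charge card_face_sums -sum_card12 -big_split /=.
rewrite (bigD1 U) // [X in _ < X](bigD1 U) //= -addSn leq_add //.
by apply: leq_sum => V _; apply: charge_le.
Qed.

Lemma face_sums_big_face U : U \in S -> 2 < #|U| ->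
  #|T|.+1 * #|S| < #|face_sums| + 'C(#|T|.+1, 2).
Proof.
move=> SU U3; apply: (@face_sums_lower_strict U).
rewrite charge_face // face_sums_over_face //.
by rewrite (leq_trans (expn2_gt U3)) ?leq_addr.
Qed.

(** The support [A :|: B] has four points. If it or one of its subsets of size 3 is a face,
    [face_sums_big_face] applies; otherwise it is charged nothing and yet carries the sum of [A] and
    [B]. *)
Lemma face_sums_disjoint_edges A B : A \in S -> B \in S -> #|A| = 2 -> #|B| = 2 ->
  [disjoint A & B] -> #|T|.+1 * #|S| < #|face_sums| + 'C(#|T|.+1, 2).
Proof.
move=> SA SB A2 B2 dAB.
have U4 : #|A :|: B| = 4 by rewrite cardsU disjoint_setI0 // cards0 A2 B2.
have [SU|SU] := boolP (A :|: B \in S).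
  by apply: (face_sums_big_face SU); rewrite U4.
have [e|[i]] := set_0Vmem (cofaces (A :|: B)).
  apply: (@face_sums_lower_strict (A :|: B)).
  rewrite charge_nonface // e cards0 addn_gt0 card_gt0; apply/orP; left.
  by apply/set0Pn; exists (A :&: B); rewrite inE; apply/imset2P; exists A B.
rewrite inE => /andP[iU Si]; apply: (face_sums_big_face Si).
by move: U4; rewrite (cardsD1 i) iU add1n => -[->].
Qed.

(** The bound has to be tight on every support. A nonface of size 2 has charge 2 and at most the one
    sum with empty intersection. For a larger nonface only the intersections [set0] and [[set v]]
    can occur, and at least as many cofaces are exhibited. *)
Lemma face_sums_star v : (forall A, A \in S -> #|A :\ v| <= 1) ->
  #|T|.+1 * #|S| = #|face_sums| + 'C(#|T|.+1, 2).
Proof.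
move=> Sv; apply/eqP; rewrite eqn_leq face_sums_lower /=.
rewrite -sum_charge card_face_sums -sum_card12 -big_split /=.
apply: leq_sum => U _.
have le2 A : A \in S -> #|A| <= 2.
  by move=> SA; rewrite (cardsD1 v) (leq_add (leq_b1 _) (Sv A SA)).
have [SU|SU] := boolP (U \in S).
  rewrite charge_face // face_sums_over_face //.
  by case: #|U| (le2 _ SU) => [|[|[|]]].
have {}le2 A : A \in S -> A \subset U -> U \notin S -> #|U| = 2 -> #|A| <= 1.
  move=> SA AU _ U2; rewrite -ltnS -U2 proper_card // properEneq AU andbT.
  by apply: contraNneq SU => <-.
rewrite charge_nonface //; have := card_nonface SU.
have [U2 _|nU2 U2] := eqVneq #|U| 2.
  have -> : cofaces U = U.
    apply/setP => i; rewrite inE; have [iU|//] := boolP (i \in U).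
    move: U2; rewrite (cardsD1 i) iU => -[/eqP/cards1P[j ->]]; exact: S_set1.
  rewrite U2 (leq_add2r 1 _ 1) -(cards1 (set0 : {set T})).
  apply/subset_leq_card/subsetP => D; rewrite !inE.
  move=> /imset2P[A B SA SB [eU eD]]; rewrite -cards_eq0 eD.
  have := cardsUI A B; rewrite -eU U2 => e; rewrite -leqn0 -(leq_add2l 2) e.
  by rewrite (leq_add (le2 A _ _ _ _) (le2 B _ _ _ _)) // eU ?subsetUl ?subsetUr.
rewrite !inE (negbTE nU2) orbF gtn_eqF // addn0.
have {nU2}U2 : 2 < #|U| by rewrite ltn_neqAle eq_sym nU2.
(* A common point [x] other than [v] would put both faces inside [[set x; v]], making [U] too
   small. *)
have fibv D : D \in face_sums_over U -> D \subset [set v].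
  rewrite inE => /imset2P[A B SA SB [eU ->]]; apply/subsetP => x; rewrite !inE.
  apply: contraLR => xv; apply: contraL U2 => /andP[xA xB]; rewrite -leqNgt eU.
  suff sub C : C \in S -> x \in C -> C \subset [set x; v].
    by apply: leq_trans (subset_leq_card (_ : _ \subset [set x; v])) _;
       rewrite ?subUset ?sub ?cards2 ?xv.
  move=> SC xC; apply/subsetP => y yC; rewrite !inE.
  have [_|yv] := eqVneq y v; rewrite ?orbT // orbF.
  have /card_le1P/(_ x) := Sv C SC; rewrite !inE xv xC => /(_ isT y).
  by rewrite !inE yv yC => <-.
have [fv|nfv] := boolP ([set v] \in face_sums_over U).
  have Pge : 1 < #|cofaces U|.
    move: fv; rewrite inE => /imset2P[A B SA SB [eU eD]].
    have : v \in A :&: B by rewrite -eD set11.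
    rewrite inE => /andP[vA vB].
    (* Neither face is [[set v]], since the other one would then be all of [U]. So [U] consists of
       [v], [a] and [b], and removing [a] or [b] leaves a face. *)
    have sing C C' : C \in S -> C' \in S -> v \in C -> v \in C' -> U = C :|: C' ->
        exists2 a, a != v & C = [set v; a].
      move=> SC SC' vC vC' eU'; have := Sv C SC; rewrite leq_eqVlt ltnS leqn0 cards_eq0.
      case/orP=> [/cards1P[a ea]|/eqP ea].
        exists a; last by rewrite -(setD1K vC) ea.
        by have : a \in [set a] := set11 a; rewrite -ea !inE => /andP[].
      case/negP: SU; rewrite eU' -(setD1K vC) ea setU0.
      by rewrite (setUidPr _) // sub1set.
    have [a av eA] := sing A B SA SB vA vB eU.
    have [b bv eB] := sing B A SB SA vB vA (etrans eU (setUC _ _)).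
    have ab : a != b.
      by apply: contraNneq SU => ab; rewrite eU eA eB ab setUid -eB.
    apply/card_gt1P; exists a, b; split=> //.
      rewrite inE eU eA eB !inE eqxx orbT /=.
      suff -> : (([set v; a] :|: [set v; b]) :\ a) = B by [].
      rewrite eB; apply/setP => x; rewrite !inE.
      have [->|xa] := eqVneq x a; first by rewrite (negbTE av) (negbTE ab).
      by case: (x == v); case: (x == b).
    rewrite inE eU eA eB !inE eqxx !orbT /=.
    suff -> : (([set v; a] :|: [set v; b]) :\ b) = A by [].
    rewrite eA; apply/setP => x; rewrite !inE.
    have [->|xb] := eqVneq x b; first by rewrite (negbTE bv) eq_sym (negbTE ab).
    by case: (x == v); case: (x == a).
  apply: leq_trans Pge; apply: (@leq_trans #|[set set0; [set v]]|).
    apply/subset_leq_card/subsetP => D /fibv; rewrite subset1 !inE.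
    by rewrite orbC.
  by rewrite cards2 ltnS leq_b1.
have fib0 D : D \in face_sums_over U -> D = set0.
  move=> fD; have := fibv D fD; rewrite subset1 => /orP[/eqP eD|/eqP //].
  by rewrite -eD fD in nfv.
have [->|[D fD]] := set_0Vmem (face_sums_over U); first by rewrite cards0.
apply: (@leq_trans 1).
  rewrite -(cards1 (set0 : {set T})); apply/subset_leq_card/subsetP => E /fib0 ->.
  by rewrite inE.
have := fD; rewrite (fib0 D fD) inE => /imset2P[A B SA SB [eU /esym e0]].
(* The two faces are now disjoint, so one of them avoids [v] and is a singleton; removing its point
   from [U] leaves the other face. *)
have cof C C' : C \in S -> U = C :|: C' -> C :&: C' = set0 -> #|C'| == 1 -> 0 < #|cofaces U|.
  move=> SC eU' e /cards1P[i eC']; apply/card_gt0P; exists i.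
  rewrite inE eU' eC' !inE eqxx orbT /= setDUl setDv setU0.
  by rewrite (setDidPl _) // -setI_eq0 -eC' e.
have size C C' : C \in S -> U = C :|: C' -> C' \in S -> 0 < #|C|.
  by move=> SC eU' SC'; rewrite card_gt0; apply: contraNneq SU => e; rewrite eU' e set0U.
have hA := size A B SA eU SB; have hB := size B A SB (etrans eU (setUC _ _)) SA.
have [A1|A1] := eqVneq #|A| 1.
  by apply: (cof B A); rewrite ?A1 // 1?setUC // setIC.
have [B1|B1] := eqVneq #|B| 1; first by apply: (cof A B); rewrite ?B1.
have inv C : C \in S -> 0 < #|C| -> #|C| != 1 -> v \in C.
  move=> SC C0 C1; have := Sv C SC; have := cardsD1 v C.
  by case: (v \in C) => //; rewrite add0n => <-; rewrite leqNgt ltn_neqAle eq_sym C1 C0.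
by have : v \in A :&: B; [rewrite inE !inv | rewrite e0 inE].
Qed.

End SumsOfFaces.

Local Open Scope ring_scope.

(** * Krull dimension of subalgebras of polynomial rings *)

Section PrimeIdeals.
Variables (A : comNzRingType) (P : {pred A}).
Hypothesis primeP : prime_ideal P.

Lemma prime_ideal0 : 0 \in P. Proof. by case: primeP => -[]. Qed.

Lemma prime_ideal1 : 1 \notin P. Proof. by case: primeP => -[]. Qed.

Lemma prime_idealMl a u : u \in P -> a * u \in P.
Proof.
case: primeP => -[P0 _ cl] _ Pu.
by have := cl a u 0 Pu P0; rewrite addr0.
Qed.

Lemma prime_idealMr a u : u \in P -> u * a \in P.
Proof. by rewrite mulrC; apply: prime_idealMl. Qed.

Lemma prime_idealD u v : u \in P -> v \in P -> u + v \in P.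
Proof. by case: primeP => -[_ _ cl] _ Pu; have := cl 1 u v Pu; rewrite mul1r. Qed.

Lemma prime_idealM u v : u * v \in P -> u \notin P -> v \in P.
Proof. by case: primeP => _ /(_ u v) cl /cl /orP[->|]. Qed.

Lemma prime_idealX u e v : u ^+ e * v \in P -> u \notin P -> v \in P.
Proof.
elim: e => [|e IHe]; first by rewrite mul1r.
by move=> + uP; rewrite exprS -mulrA => /prime_idealM-/(_ uP)/IHe; apply.
Qed.

Lemma prime_ideal_sum (I : Type) (r : seq I) (Q : pred I) (F : I -> A) :
  (forall i, Q i -> F i \in P) -> \sum_(i <- r | Q i) F i \in P.
Proof.
by move=> QF; apply: (big_ind (fun x => x \in P)) => //;
   [exact: prime_ideal0 | exact: prime_idealD].
Qed.

End PrimeIdeals.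

(* A relation in P 0 is divided by the smallest power of x 0 occurring in it and
   reduced modulo x 0, which gives a nonzero relation in P 1 not involving x 0. *)
Lemma prime_chain_indep (k : fieldType) (A : comNzRingType) (c : k -> A)
    (J : finType) (q : J -> k) (d : nat) (pr : pred J) (al : J -> nat -> nat)
    (x : nat -> A) (P : nat -> {pred A}) :
  (forall a, a != 0 -> exists b, b * c a = 1) ->
  (forall i, (i <= d)%N -> prime_ideal (P i)) ->
  (forall i, (i < d)%N -> {subset P i <= P i.+1}) ->
  (forall i, (i < d)%N -> x i \in P i.+1) ->
  (forall i, (i < d)%N -> x i \notin P i) ->
  (exists j, pr j) -> (forall j, pr j -> q j != 0) ->
  {in pr &, forall j j', (forall i, (i < d)%N -> al j i = al j' i) -> j = j'} ->
  \sum_(j | pr j) c (q j) * \prod_(i < d) x i ^+ al j i \notin P 0.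
Proof.
move=> c_unit; elim: d => [|d IHd] in pr al x P *.
  move=> /(_ 0%N isT) prP _ _ _ [j prj] q0 inj.
  (* With no element left, [inj] allows only one index, so the sum is a unit constant. *)
  rewrite (big_pred1 j) => [|j']; last first.
    by apply/idP/eqP => [prj'|->//]; apply: inj.
  rewrite big_ord0 mulr1; have [b bc] := c_unit _ (q0 _ prj).
  by apply: contraNN (prime_ideal1 prP) => /(prime_idealMl prP b); rewrite bc.
move=> prP subP xP xnP [j0 prj0] q0 inj; apply/negP => sP.
case: (arg_minnP (fun j => al j 0%N) prj0) => j1 prj1; set e := al j1 0%N => min_e.
pose pr' j := pr j && (al j 0%N == e).
pose F j := c (q j) * \prod_(i < d) x i.+1 ^+ al j i.+1.
have sE : \sum_(j | pr j) c (q j) * \prod_(i < d.+1) x i ^+ al j i =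
    x 0%N ^+ e * (\sum_(j | pr' j) F j +
      \sum_(j | pr j && (al j 0%N != e)) x 0%N ^+ (al j 0%N - e) * F j).
  rewrite (bigID (fun j => al j 0%N == e)) /= mulrDr !mulr_sumr.
  congr (_ + _); apply: eq_bigr => j /andP[prj alj]; rewrite big_ord_recl mulrCA.
    by rewrite (eqP alj).
  by rewrite [RHS]mulrA -exprD subnKC ?min_e.
rewrite sE in sP; have {sE sP} := prime_idealX (prP 0%N isT) sP (xnP 0%N isT).
move=> /(subP 0%N isT) sP.
have x0P j : pr j && (al j 0%N != e) -> x 0%N ^+ (al j 0%N - e) * F j \in P 1%N.
  move=> /andP[prj alj]; apply: prime_idealMr; first exact: prP.
  have : (0 < al j 0%N - e)%N by rewrite subn_gt0 ltn_neqAle eq_sym alj min_e.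
  case: (_ - _)%N => // u _; rewrite exprSr.
  by apply: prime_idealMl; [exact: prP | exact: xP].
have {x0P}x0P := prime_ideal_sum (prP 1%N isT) (index_enum J) x0P.
have : \sum_(j | pr' j) F j \in P 1%N.
  rewrite -[X in X \in _](addrK (\sum_(j | pr j && (al j 0%N != e))
    x 0%N ^+ (al j 0%N - e) * F j)) -[- _]mulN1r; apply: prime_idealD => //; first exact: prP.
  by apply: prime_idealMl => //; exact: prP.
apply/negP; apply: (IHd pr' (fun j i => al j i.+1) (fun i => x i.+1) (fun i => P i.+1)).
- by move=> i id; apply: prP.
- by move=> i id; apply: subP.
- by move=> i id; apply: xP.
- by move=> i id; apply: xnP.
- by exists j1; rewrite /pr' prj1 eqxx.
- by move=> j /andP[/q0].
- move=> j j' /andP[prj /eqP ej] /andP[prj' /eqP ej'] H; apply: inj => // -[|i] id.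
    by rewrite ej ej'.
  exact: H.
Qed.

(** * Algebraic dependence of d + 1 polynomials in d variables *)

Section AlgebraicDependence.
Variables (k : fieldType) (d : nat).
Local Notation W := {mpoly k[d]}.

Definition mdeg_le (K : nat) : {pred W} := fun p => all (fun m => mdeg m <= K)%N (msupp p).

Lemma mdeg_leP K p : reflect (forall m, (K < mdeg m)%N -> p@_m = 0) (p \in mdeg_le K).
Proof.
apply: (iffP allP) => [H m|H m]; last first.
  by rewrite mcoeff_msupp leqNgt; apply: contraNN => /H ->.
rewrite ltnNge => /negP mK; apply/eqP; rewrite mcoeff_eq0; apply/negP => /H //.
Qed.

Lemma mdeg_le1 K : 1 \in mdeg_le K.
Proof. by apply/mdeg_leP => m; rewrite mcoeff1; case: eqP => // ->; rewrite mdeg0. Qed.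

Lemma mdeg_leM K K' p q : p \in mdeg_le K -> q \in mdeg_le K' -> p * q \in mdeg_le (K + K').
Proof.
move=> /allP pK /allP qK; apply/allP => m /msuppM_le /allpairsP[[a b] /= [ap bq ->]].
by rewrite mdegD leq_add ?pK ?qK.
Qed.

Lemma mdeg_leX K p e : p \in mdeg_le K -> p ^+ e \in mdeg_le (K * e).
Proof.
move=> pK; elim: e => [|e IHe]; first by rewrite muln0 mdeg_le1.
by rewrite exprS mulnS mdeg_leM.
Qed.

Lemma mdeg_le_prod (I : finType) (K : I -> nat) (p : I -> W) :
  (forall i, p i \in mdeg_le (K i)) -> \prod_i p i \in mdeg_le (\sum_i K i).
Proof.
move=> H; apply: (big_rec2 (fun p K => p \in mdeg_le K)); first exact: mdeg_le1.
by move=> i p' K' _; apply: mdeg_leM.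
Qed.

(* The D ^ d.+1 products of powers less than D of the f i have degree less than
   b D, hence lie in a space of dimension at most b ^ d * D ^ d, and b ^ d < D. *)
Lemma mpoly_alg_dep (f : 'I_d.+1 -> W) :
  exists (D : nat) (q : {ffun 'I_d.+1 -> 'I_D} -> k),
    (exists al, q al != 0) /\
    \sum_al (q al)%:MP * \prod_i f i ^+ al i = 0.
Proof.
pose c := \max_i msize (f i).
have fc i : f i \in mdeg_le c.
  apply/allP => m /msize_mdeg_lt /ltnW /leq_trans; apply; exact: leq_bigmax.
pose b := (c * d.+1).+1; pose D := (b ^ d).+1; pose K := (b * D)%N.
exists D; pose J := {ffun 'I_d.+1 -> 'I_D}; pose B := {ffun 'I_d -> 'I_K}.
pose g (al : J) : W := \prod_i f i ^+ al i.
have gK al m : (K <= mdeg m)%N -> (g al)@_m = 0.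
  move=> Km; have : g al \in mdeg_le (\sum_(i < d.+1) c * al i).
    by apply: mdeg_le_prod => i; apply: mdeg_leX.
  move/mdeg_leP; apply; apply: leq_trans Km; rewrite /K /b mulSn.
  rewrite -addn1 addnC leq_add // -mulnA.
  rewrite -big_distrr leq_mul2l; apply/orP; right.
  rewrite -[d.+1 in leqRHS]card_ord -sum_nat_const; apply: leq_sum => i _; exact: ltnW.
pose mB (be : B) := [multinom (be i : nat) | i < d].
pose M := \matrix_(i < #|J|, j < #|B|) (g (enum_val i))@_(mB (enum_val j)).
have ltBJ : (#|B| < #|J|)%N.
  by rewrite !card_ffun !card_ord /K expnMn expnS ltn_pmul2r // expn_gt0.
(* The rows of [M] outnumber its columns; a nonzero vector of the left kernel lists the coefficients
   of the relation. *)
have : kermx M != 0.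
  rewrite -mxrank_eq0 mxrank_ker -lt0n subn_gt0.
  exact: leq_ltn_trans (rank_leq_col M) ltBJ.
case/rowV0Pn => v /sub_kermxP vM v0.
exists (fun al => v 0 (enum_rank al)); split.
  by have [i vi] := rV0Pn _ v0; exists (enum_val i); rewrite enum_valK.
apply/mpolyP => m; rewrite mcoeff0 raddf_sum /=.
have [Km|mK] := leqP K (mdeg m).
  by apply: big1 => al _; rewrite mcoeffCM gK // mulr0.
have mi (i : 'I_d) : (m i < K)%N.
  by apply: leq_ltn_trans mK; rewrite mdegE (bigD1 i) // leq_addr.
pose be : B := [ffun i => Ordinal (mi i)].
have em : mB be = m by apply/mnmP => i; rewrite mnmE ffunE.
have := congr1 (fun w : 'rV_#|B| => w 0 (enum_rank be)) vM; rewrite !mxE => {2}<-.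
rewrite (reindex (@enum_val J predT)) /=; last exact/onW_bij/enum_val_bij.
by apply: eq_bigr => i _; rewrite mcoeffCM enum_valK mxE enum_rankK em.
Qed.

End AlgebraicDependence.

(** * Krull dimension: uniqueness, and its value for subalgebras *)

Lemma krull_dim_inj (A : comNzRingType) d d' : krull_dim A d -> krull_dim A d' -> d = d'.
Proof.
move=> [[P chP] max] [[P' chP'] max']; apply/eqP.
by rewrite eqn_leq (max' _ P) // (max _ P').
Qed.

Section KrullDimension.
Variables (k : fieldType) (d : nat) (A : comNzRingType).
Local Notation W := {mpoly k[d]}.
Variables (Phi : {rmorphism A -> W}) (c : k -> A).
Hypothesis Phi_c : forall a, Phi (c a) = a%:MP.
Hypothesis Phi_inj : injective Phi.

(** From a longer chain pick, for i up to d, an element [x i] of the ideal of index i + 1 outside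
    the one of index i. The images of these d + 1 elements satisfy a polynomial relation, which
    pulls back along the injective [Phi] and contradicts [prime_chain_indep]. *)
Lemma prime_chain_le (e : nat) (P : 'I_e.+1 -> {pred A}) :
  prime_chain P -> (e <= d)%N.
Proof.
move=> [prP chP]; rewrite leqNgt; apply/negP => de.
have ord_lt i : (i < e)%N -> ((inord i : 'I_e.+1) < (inord i.+1 : 'I_e.+1))%N.
  by move=> ie; rewrite !inordK // ltnS ltnW.
have exP i : exists x, (i < e)%N -> x \in P (inord i.+1) /\ x \notin P (inord i).
  have [ie|] := boolP (i < e)%N; last by exists 0.
  have [_ /existsNP[y /not_implyP[yP yP']]] := chP _ _ (ord_lt _ ie).
  by exists y => _; split=> //; apply/negP.
have [x xP] := choice exP.
have [D [q [[al0 q0] rel]]] := mpoly_alg_dep (fun i : 'I_d.+1 => Phi (x i)).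
pose al (j : {ffun 'I_d.+1 -> 'I_D}) (i : nat) : nat := j (inord i).
have := @prime_chain_indep k A c _ q d.+1 (fun j => q j != 0) al x (fun i => P (inord i)).
have -> : \sum_(j | q j != 0) c (q j) * \prod_(i < d.+1) x i ^+ al j i = 0.
  apply: Phi_inj; rewrite rmorph0 -[RHS]rel rmorph_sum [RHS](bigID (fun j => q j != 0)) /=.
  rewrite [X in _ = _ + X]big1 => [|j /negPn/eqP ->]; last by rewrite mpolyC0 mul0r.
  rewrite addr0; apply: eq_bigr => j _; rewrite rmorphM Phi_c rmorph_prod; congr (_ * _).
  by apply: eq_bigr => i _; rewrite rmorphXn /al inord_val.
rewrite prime_ideal0 //; move=> H; suff: ~~ true by []; apply: H.
- move=> a a0; exists (c a^-1); apply: Phi_inj.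
  by rewrite rmorphM !Phi_c rmorph1 -mpolyCM mulVf.
- by [].
- by move=> i id; have [] := chP _ _ (ord_lt i (leq_trans id de)).
- by move=> i id; have [] := xP i (leq_trans id de).
- by move=> i id; have [] := xP i (leq_trans id de).
- by exists al0.
- by [].
- move=> j j' _ _ H; apply/ffunP => i; apply/val_inj.
  by have := H i (ltn_ord i); rewrite /al inord_val.
Qed.

(** Killing the variables before [i] preserves such a monomial and killing [i] as well destroys it,
    which makes the inclusions between the kernels below strict. *)
Hypothesis Phi_X : forall i : 'I_d, exists a m, [/\ Phi a = 'X_[m], m i != 0%N &
  forall i' : 'I_d, (i' < i)%N -> m i' = 0%N].

Definition kill_vars (j : nat) : W -> W :=
  mmap (@mpolyC d k) (fun i : 'I_d => if (i < j)%N then 0 else 'X_i).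

HB.instance Definition _ j := GRing.RMorphism.copy (kill_vars j)
  (mmap (@mpolyC d k) (fun i : 'I_d => if (i < j)%N then 0 else 'X_i)).

Lemma kill_varsC j a : kill_vars j a%:MP = a%:MP.
Proof. exact: mmapC. Qed.

Lemma kill_varsX j (m : 'X_{1..d}) : kill_vars j 'X_[m] =
  if [exists i : 'I_d, (i < j)%N && (m i != 0%N)] then 0 else 'X_[m].
Proof.
rewrite /kill_vars mmapX /mmap1; case: ifP => [/existsP[i /andP[ij mi]]|/negbT/existsPn H].
  by rewrite (bigD1 i) //= ij expr0n (negbTE mi) mul0r.
rewrite [RHS]mpolyXE_id; apply: eq_bigr => i _; have := H i.
by case: ifP => //= _ /negPn/eqP ->; rewrite !expr0.
Qed.

Lemma kill_vars_comp j j' p : (j <= j')%N -> kill_vars j' (kill_vars j p) = kill_vars j' p.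
Proof.
move=> jj'; elim/mpolyind: p => [|a m p _ _ IHp]; first by rewrite !raddf0.
rewrite !raddfD /= IHp; congr (_ + _).
rewrite -mul_mpolyC [kill_vars j _]rmorphM !rmorphM /= !kill_varsC; congr (_ * _).
rewrite (kill_varsX j).
case: ifP => // /existsP[i /andP[ij mi]]; rewrite [LHS]raddf0 kill_varsX.
by case: existsP => // -[]; exists i; rewrite mi (leq_trans ij jj').
Qed.

Definition kill_ideal (j : nat) : {pred A} := fun a => kill_vars j (Phi a) == 0.

(** This is the kernel of a morphism from [A] to the domain [W]. *)
Lemma kill_ideal_prime j : prime_ideal (kill_ideal j).
Proof.
split; first split.
- by rewrite unfold_in rmorph0 rmorph0.
- by rewrite unfold_in rmorph1 rmorph1 oner_eq0.
- move=> a u v; rewrite !unfold_in rmorphD rmorphM /= rmorphD rmorphM /=.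
  by move=> /eqP -> /eqP ->; rewrite mulr0 addr0.
- by move=> u v; rewrite !unfold_in rmorphM /= rmorphM /= mulf_eq0.
Qed.

Lemma kill_ideal_chain : prime_chain (fun j : 'I_d.+1 => kill_ideal j).
Proof.
split=> [j|j j' jj']; first exact: kill_ideal_prime.
split=> [a|].
  by rewrite !unfold_in -(kill_vars_comp _ (ltnW jj')) => /eqP ->; rewrite rmorph0.
have jd : (j < d)%N by rewrite (leq_trans jj') // -ltnS.
have [a [m [Pa mj m0]]] := Phi_X (Ordinal jd).
move/(_ a); rewrite !unfold_in Pa !kill_varsX.
case: existsP => [_|[]]; last by exists (Ordinal jd); rewrite jj' mj.
case: existsP => [[i /andP[ij mi]] _|_ /(_ (eqxx _))].
  by rewrite m0 in mi.
by move=> /eqP/(congr1 (mcoeff m)); rewrite mcoeffX mcoeff0 eqxx => /eqP; rewrite oner_eq0.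
Qed.

Lemma krull_dim_subalgebra : krull_dim A d.
Proof.
split; last exact: prime_chain_le.
by exists (fun j => kill_ideal j); exact: kill_ideal_chain.
Qed.

End KrullDimension.

(** * Monomial ideals *)

Lemma min_num_gens_inj (A : comNzRingType) (I : {pred A}) r r' :
  min_num_gens I r -> min_num_gens I r' -> r = r'.
Proof.
move=> [[t It] min] [[t' It'] min']; apply/eqP.
by rewrite eqn_leq (min _ t') // (min' _ t).
Qed.

Lemma ideal_gen_tuple (A : comNzRingType) (r : nat) (t : r.-tuple A) p :
  p \in ideal_gen (mem t) -> exists c : 'I_r -> A, p = \sum_l c l * tnth t l.
Proof.
move: p; apply: ideal_gen_ind.
- by exists (fun=> 0); rewrite big1 // => l _; rewrite mul0r.
- move=> _ _ [c ->] [c' ->]; exists (fun l => c l + c' l).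
  by rewrite -big_split; apply: eq_bigr => l _; rewrite mulrDl.
- move=> c s /tnthP[l ->]; exists (fun l' => if l' == l then c else 0).
  rewrite (bigD1 l) //= eqxx big1 ?addr0 // => l' /negbTE ->; exact: mul0r.
Qed.

Section MonomialIdeals.
Variables (k : fieldType) (N : nat).
Local Notation R := {mpoly k[N]}.
Local Notation mon := 'X_{1..N}.
Implicit Types (M : mon -> Prop) (p q : R) (m : mon).

(** Monomial ideals are handled through their sets of exponents: under [mon_up M] this is the ideal
    having the monomials of [M] as a k-basis. *)
Definition mon_ideal M : {pred R} := fun p => `[< forall m, m \in msupp p -> M m >].

Definition mon_up M : Prop := forall a m, M m -> M (a + m)%MM.

Definition mon_mul M M' : mon -> Prop :=
  fun m => exists a b, [/\ M a, M' b & m = (a + b)%MM].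

Definition mon_pow M (i : nat) : mon -> Prop := iter i (mon_mul M) (fun=> True).

Lemma mon_ideal0 M : 0 \in mon_ideal M.
Proof. by apply/asboolP => m; rewrite mcoeff_msupp mcoeff0 eqxx. Qed.

Lemma mon_idealD M p q : p \in mon_ideal M -> q \in mon_ideal M -> p + q \in mon_ideal M.
Proof.
move=> /asboolP Mp /asboolP Mq; apply/asboolP => m /msuppD_le.
by rewrite mem_cat => /orP[/Mp|/Mq].
Qed.

Lemma mon_idealM M p q : mon_up M -> q \in mon_ideal M -> p * q \in mon_ideal M.
Proof.
move=> up /asboolP Mq; apply/asboolP => m /msuppM_le/allpairsP[[a b] /= [_ bq ->]].
exact/up/Mq.
Qed.

Lemma mon_idealX M m : 'X_[m] \in mon_ideal M <-> M m.
Proof.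
split=> [/asboolP|Mm]; first by apply; rewrite msuppX mem_head.
by apply/asboolP => m'; rewrite msuppX inE => /eqP ->.
Qed.

Lemma mon_ideal_sub M (J : {pred R}) :
  0 \in J -> (forall p q, p \in J -> q \in J -> p + q \in J) ->
  (forall a p, p \in J -> a * p \in J) ->
  (forall m, M m -> 'X_[m] \in J) -> {subset mon_ideal M <= J}.
Proof.
move=> J0 JD JM JX p /asboolP Mp; rewrite [p]mpolyE big_seq_cond.
apply: (big_ind (fun x => x \in J)) => // m /andP[/Mp/JX mp _].
by rewrite -mul_mpolyC JM.
Qed.

Lemma ideal_gen_mon M (S : {pred R}) :
  mon_up M -> {subset S <= mon_ideal M} ->
  (forall m, M m -> exists a b, 'X_[b] \in S /\ m = (a + b)%MM) ->
  ideal_gen S =i mon_ideal M.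
Proof.
move=> up SM MS p; apply/idP/idP.
  move: p; apply: ideal_gen_ind => [|p q|c s /SM]; first exact: mon_ideal0.
    exact: mon_idealD.
  exact: mon_idealM.
apply: mon_ideal_sub => [|q q'|a q|m /MS[a [b [Sb ->]]]]; first exact: ideal_gen0.
- exact: ideal_genD.
- exact: ideal_genM.
- by rewrite mpolyXD; apply/ideal_genM/ideal_gen_in.
Qed.

Lemma mon_mul_up M M' : mon_up M' -> mon_up (mon_mul M M').
Proof.
move=> up a _ [x [y [Mx My ->]]]; exists x, (a + y)%MM.
by rewrite addmA [(a + x)%MM]addmC -addmA; split=> //; apply: up.
Qed.

Lemma mon_pow_up M i : mon_up (mon_pow M i).
Proof. by elim: i => [|i IHi] //; apply: mon_mul_up. Qed.

Lemma ideal_mul_mon M M' (I J : {pred R}) : mon_up M' ->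
  I =i mon_ideal M -> J =i mon_ideal M' -> ideal_mul I J =i mon_ideal (mon_mul M M').
Proof.
move=> up IM JM; apply: ideal_gen_mon; first exact: mon_mul_up.
  move=> _ /asboolP[a [b [+ + ->]]]; rewrite IM JM => /asboolP Ma /asboolP Mb.
  apply/asboolP => m /msuppM_le/allpairsP[[x y] /= [ax ay ->]].
  by exists x, y; split; [exact: Ma | exact: Mb | ].
move=> _ [a [b [Ma Mb ->]]]; exists 0%MM, (a + b)%MM; rewrite add0m; split=> //.
apply/asboolP; exists 'X_[a], 'X_[b].
by rewrite IM JM mpolyXD; split=> //; apply/mon_idealX.
Qed.

Lemma ideal_exp_mon M (I : {pred R}) i :
  I =i mon_ideal M -> ideal_exp I i =i mon_ideal (mon_pow M i).
Proof.
move=> IM; elim: i => [|i IHi] /=; first by move=> p; apply/esym/asboolP.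
by apply: ideal_mul_mon => //; apply: mon_pow_up.
Qed.

Lemma homog_max_ideal_mon : @homog_max_ideal k N =i mon_ideal (fun m => m != 0%MM).
Proof.
apply: ideal_gen_mon => [a m|p /existsP[i /eqP ->]|m].
- by rewrite mnmD_eq0 negb_and => ->; rewrite orbT.
- by apply/mon_idealX; rewrite mnm1_eq0.
- rewrite -mdeg_eq0 mdegE sum_nat_eq0 negb_forall => /existsP[i mi].
  exists (m - U_(i))%MM, U_(i)%MM; split; first by apply/existsP; exists i.
  by rewrite submK // lep1mP.
Qed.

Definition cover_mon (H : sgraph N) m : Prop := forall u v, H u v -> m u != 0%N \/ m v != 0%N.

Lemma cover_mon_up H : mon_up (cover_mon H).
Proof.
move=> a m Hm u v /Hm; rewrite !mnmDE !addn_eq0 !negb_and.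
by case=> ->; rewrite orbT; [left | right].
Qed.

Lemma cover_ideal_mon H : cover_ideal k H =i mon_ideal (cover_mon H).
Proof.
have genE u v : ideal_gen (pred2 'X_u 'X_v : {pred R}) =i
    mon_ideal (fun m => m u != 0%N \/ m v != 0%N).
  apply: ideal_gen_mon => [a m|p|m].
  - by rewrite !mnmDE !addn_eq0 !negb_and; case=> ->; rewrite orbT; [left | right].
  - rewrite inE => /pred2P[] ->; apply/mon_idealX; rewrite !mnm1E eqxx; first by left.
    by right.
  - have sub w : m w != 0%N -> m = (m - U_(w) + U_(w))%MM by rewrite -lep1mP => /submK.
    case=> /sub e; [exists (m - U_(u))%MM, U_(u)%MM | exists (m - U_(v))%MM, U_(v)%MM];
      by rewrite inE eqxx ?orbT.
move=> p; apply/asboolP/asboolP => [Jp m mp u v Huv|Jp u v Huv].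
  by have := Jp u v Huv; rewrite genE => /asboolP/(_ m mp).
by rewrite genE; apply/asboolP => m /Jp/(_ u v Huv).
Qed.

Lemma mon_ideal_monomial M (I : {pred R}) :
  mon_up M -> I =i mon_ideal M -> monomial_ideal I.
Proof.
move=> up IM p; rewrite IM; apply/esym; move: p; apply: ideal_gen_mon => // [p|m Mm].
  by case/asboolP => m -> ; rewrite IM.
exists 0%MM, m; rewrite add0m; split=> //; apply/asboolP; exists m => //.
by rewrite IM; apply/mon_idealX.
Qed.

(** Without its constant term [p] raises degrees, so it contributes nothing to [p * q] in degree
    [d], the least one possible for [q]. *)
Lemma mcoeffM_low d p q e : (forall m, m \in msupp q -> (d <= mdeg m)%N) ->
  mdeg e = d -> (p * q)@_e = p@_0%MM * q@_e.
Proof.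
move=> qd ed; rewrite -[p in LHS](subrK (p@_0%MM)%:MP) mulrDl mcoeffD mcoeffCM.
suff -> : ((p - (p@_0%MM)%:MP) * q)@_e = 0 by rewrite add0r.
apply: memN_msupp_eq0; apply/negP => /msuppM_le/allpairsP[[a b] /= [ap bq ee]].
have := qd b bq; rewrite -ed ee mdegD -{2}[mdeg b]add0n leq_add2r leqn0 mdeg_eq0.
by move=> /eqP a0; move: ap; rewrite a0 mcoeff_msupp mcoeffB mcoeffC eqxx mulr1 subrr eqxx.
Qed.

(* The degree d parts of the elements of any generating tuple span the space with
   basis E. *)
Lemma min_num_gens_mon M (I : {pred R}) (d : nat) (E : seq mon) :
  mon_up M -> I =i mon_ideal M -> uniq E ->
  (forall e, e \in E -> M e /\ mdeg e = d) ->
  (forall m, M m -> exists a e, e \in E /\ m = (a + e)%MM) ->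
  min_num_gens I (size E).
Proof.
move=> up IM uE Ed ME; pose s := [seq 'X_[e] : R | e <- E].
have sI : ideal_gen (mem s) =i mon_ideal M.
  apply: ideal_gen_mon => // [_ /mapP[e /Ed[Me _] ->]|m /ME[a [e [eE ->]]]].
    exact/mon_idealX.
  by exists a, e; split=> //; apply: map_f.
split.
  have ss : size s == size E by rewrite size_map.
  by exists (Tuple ss) => p; rewrite IM -sI.
move=> r t It.
have tI l : tnth t l \in mon_ideal M by rewrite -IM It ideal_gen_in // mem_tnth.
have tdeg l m : m \in msupp (tnth t l) -> (d <= mdeg m)%N.
  move: (tI l) => /asboolP H /H /ME[a [e [/Ed[_ <-] ->]]].
  by rewrite mdegD leq_addl.
have e_in (j : 'I_(size E)) : tnth (in_tuple E) j \in E by rewrite mem_tnth.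
have ex j : exists c : 'I_r -> R, 'X_[tnth (in_tuple E) j] = \sum_l c l * tnth t l.
  by apply: ideal_gen_tuple; rewrite -It IM; apply/mon_idealX; have [] := Ed _ (e_in j).
have [c cE] := boolp.choice ex.
(* [C] holds the constant terms of the coefficients, [T] the coordinates of the generators on [E].
   By [mcoeffM_low] their product is the identity, so its rank [size E] is at most [r]. *)
pose C := \matrix_(j < size E, l < r) (c j l)@_0%MM.
pose T := \matrix_(l < r, j < size E) (tnth t l)@_(tnth (in_tuple E) j).
have CT : C *m T = 1%:M.
  have /tuple_uniqP injE : uniq (in_tuple E) by [].
  apply/matrixP => i j; rewrite !mxE.
  have := congr1 (mcoeff (tnth (in_tuple E) j)) (cE i).
  rewrite mcoeffX raddf_sum /= (inj_eq injE) => ->.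
  apply: eq_bigr => l _; rewrite !mxE (mcoeffM_low _ (tdeg l)) //.
  by have [] := Ed _ (e_in j).
rewrite -[X in (X <= _)%N](mxrank1 k (size E)) -CT.
exact: leq_trans (mxrankM_maxl _ _) (rank_leq_col _).
Qed.

End MonomialIdeals.

(** * The fiber cone of the cover ideal of a whiskering *)

Section LastVariable.
Variables (k : fieldType) (n : nat).
Local Notation W := {mpoly k[n]}.
Local Notation W1 := {mpoly k[n.+1]}.

(** Brings k[z_1, ..., z_n][T] into the form required by [krull_dim_subalgebra], with T as the last
    variable; [muni] is a left inverse. *)
Definition last_var (p : {poly W}) : W1 := (map_poly (@mwiden n k) p).['X_ord_max].

Lemma last_var_comm : commr_rmorph (@mwiden n k) ('X_ord_max : W1).
Proof. by move=> x; apply: mulrC. Qed.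

HB.instance Definition _ := GRing.RMorphism.copy last_var (horner_morph last_var_comm).

Lemma last_varC p : last_var p%:P = mwiden p.
Proof. exact: (horner_morphC last_var_comm p). Qed.

Lemma last_varX : last_var 'X = 'X_ord_max.
Proof. exact: (horner_morphX last_var_comm). Qed.

Lemma muniX (m : 'X_{1..n.+1}) : muni ('X_[m] : W1) =
  'X_[[multinom m (widen_ord (leqnSn n) i) | i < n]] *: 'X^(m ord_max).
Proof. by rewrite muniE msuppX big_seq1 mcoeffX eqxx scale1r. Qed.

Lemma muni_mwiden (p : W) : muni (mwiden p) = p%:P.
Proof.
elim/mpolyind: p => [|a m p _ _ IHp]; first by rewrite !raddf0.
rewrite !raddfD /= IHp mwidenZ mwidenX muniZ muniX mnmwiden_ordmax expr0.
rewrite -!mul_polyC mulr1 -polyCM mul_mpolyC; congr (_%:P + _).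
by congr (_ *: 'X_[_]); apply/mnmP => i; rewrite mnmE mnmwiden_widen.
Qed.

Lemma last_varK : cancel last_var (@muni n k).
Proof.
move=> p; elim/poly_ind: p => [|p a IHp]; first by rewrite !rmorph0.
rewrite !rmorphD !rmorphM /= IHp last_varC last_varX muni_mwiden muniX.
rewrite mnm1E eqxx expr1.
have -> : [multinom (U_(ord_max : 'I_n.+1) : 'X_{1..n.+1})%MM (widen_ord (leqnSn n) i)
    | i < n] = 0%MM.
  by apply/mnmP => i; rewrite mnmE mnm0E mnm1E -val_eqE gtn_eqF /=.
by rewrite mpolyX0 scale1r.
Qed.

End LastVariable.

(** * Vertex covers of the whiskering and exponents in powers of the cover ideal *)

Section Whiskering.
Variables (k : fieldType) (n : nat) (G : sgraph n).
Local Notation R := {mpoly k[n + n]}.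
Local Notation W := {mpoly k[n]}.
Local Notation mon := 'X_{1..n + n}.
Let C := cover_mon (whiskering G).

Definition independents : {set {set 'I_n}} :=
  [set A : {set 'I_n} | [forall i in A, forall j in A, ~~ G i j]].

Lemma independentsP (A : {set 'I_n}) :
  reflect {in A &, forall i j, ~~ G i j} (A \in independents).
Proof.
rewrite inE; apply: (iffP forall_inP) => [H i j iA jA|H i iA].
  by have /forall_inP := H i iA; apply.
by apply/forall_inP => j jA; apply: H.
Qed.

Lemma whisker_xx i j : whiskering G (lshift n i) (lshift n j) = G i j.
Proof. by rewrite /= /whisker_adj (unsplitK (inl i)) (unsplitK (inl j)). Qed.

Lemma whisker_xy i j : whiskering G (lshift n i) (rshift n j) = (i == j).
Proof. by rewrite /= /whisker_adj (unsplitK (inl i)) (unsplitK (inr j)). Qed.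

Lemma whisker_yx i j : whiskering G (rshift n i) (lshift n j) = (i == j).
Proof. by rewrite /= /whisker_adj (unsplitK (inr i)) (unsplitK (inl j)). Qed.

Lemma whisker_yy i j : whiskering G (rshift n i) (rshift n j) = false.
Proof. by rewrite /= /whisker_adj (unsplitK (inr i)) (unsplitK (inr j)). Qed.

Definition cover_of (A : {set 'I_n}) : mon :=
  [multinom match split v with inl i => (i \notin A : nat) | inr i => (i \in A : nat) end
  | v < n + n].

Lemma cover_of_x A i : cover_of A (lshift n i) = (i \notin A).
Proof. by rewrite mnmE (unsplitK (inl i)). Qed.

Lemma cover_of_y A i : cover_of A (rshift n i) = (i \in A).
Proof. by rewrite mnmE (unsplitK (inr i)). Qed.

Lemma mdeg_split (m : mon) : mdeg m = (\sum_(j < n) (m (lshift n j) + m (rshift n j)))%N.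
Proof. by rewrite mdegE big_split_ord big_split. Qed.

Lemma mdeg_cover_of A : mdeg (cover_of A) = n.
Proof.
rewrite mdeg_split (eq_bigr (fun=> 1%N)) ?sum1_card ?card_ord // => j _.
by rewrite cover_of_x cover_of_y; case: (j \in A).
Qed.

Lemma cover_of_cover A : A \in independents -> C (cover_of A).
Proof.
move=> /independentsP indA u v; rewrite -[u]splitK -[v]splitK.
case: (split u) => i; case: (split v) => j; rewrite /unsplit.
- rewrite whisker_xx !cover_of_x => Gij; case: (boolP (i \in A)) => iA; last by left.
  by right; case: (boolP (j \in A)) => // /(indA i j iA); rewrite Gij.
- rewrite whisker_xy cover_of_x cover_of_y => /eqP ->.
  by case: (j \in A); [right | left].
- rewrite whisker_yx cover_of_x cover_of_y => /eqP ->.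
  by case: (j \in A); [left | right].
- by rewrite whisker_yy.
Qed.

(** The indices whose x exponent vanishes form an independent set, since an edge of [G] among them
    would be uncovered; the whisker edges then force their y exponents to be positive. *)
Lemma cover_decomp m : C m -> exists a A, A \in independents /\ m = (a + cover_of A)%MM.
Proof.
move=> Cm; pose A := [set i | m (lshift n i) == 0%N].
exists (m - cover_of A)%MM, A; split.
  apply/independentsP => i j; rewrite !inE => /eqP mi /eqP mj; apply/negP.
  by rewrite -whisker_xx => /Cm; rewrite mi mj => -[].
rewrite submK //; apply/mnm_lepP => v; rewrite mnmE; case: splitP => i ei.
  have -> : v = lshift n i by apply: val_inj.
  by rewrite inE; case: (m _).
have -> : v = rshift n i by apply: val_inj.
rewrite inE; case: eqP => // mi; rewrite lt0n.
by have := Cm (lshift n i) (rshift n i); rewrite whisker_xy eqxx mi => /(_ isT) [].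
Qed.

Lemma cover_pow_decomp i m : mon_pow C i m ->
  exists a b, [/\ m = (a + b)%MM, mon_pow C i b & mdeg b = (n * i)%N].
Proof.
elim: i m => [|i IHi] m /=.
  by move=> _; exists m, 0%MM; rewrite addm0 mdeg0 muln0.
move=> [_ [_ [/cover_decomp[a [A [IA ->]]] /IHi[a' [b [-> Cb db]]] ->]]].
exists (a + a')%MM, (cover_of A + b)%MM; split.
- by rewrite -!addmA; congr (_ + _)%MM; rewrite !addmA [(_ + a')%MM]addmC.
- by exists (cover_of A), b; split=> //; apply: cover_of_cover.
- by rewrite mdegD mdeg_cover_of db mulnS.
Qed.

Lemma cover_pow_ge i m j : mon_pow C i m -> (i <= m (lshift n j) + m (rshift n j))%N.
Proof.
elim: i m => [|i IHi] m //= [a [b [Ca /IHi Cb ->]]].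
rewrite !mnmDE addnACA -add1n leq_add // addn_gt0 !lt0n.
by apply/orP; apply: Ca; rewrite whisker_xy.
Qed.

Lemma cover_pow_deg i m : mon_pow C i m -> (n * i <= mdeg m)%N.
Proof.
move=> Cm; rewrite mdeg_split -[n in (n * _)%N]card_ord -sum_nat_const.
by apply: leq_sum => j _; apply: cover_pow_ge.
Qed.

(** The n inequalities of [cover_pow_ge] add up to an equality, so each of them is one. Hence the y
    exponents determine the x exponents. *)
Lemma cover_pow_eq i m j : mon_pow C i m -> mdeg m = (n * i)%N ->
  (m (lshift n j) + m (rshift n j))%N = i.
Proof.
move=> Cm; rewrite mdeg_split -[n in (n * _)%N]card_ord -sum_nat_const => /esym/eqP.
have [_ ->] := leqif_sum (fun l (_ : predT l) => leqif_eq (cover_pow_ge l Cm)).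
by move=> /forallP/(_ j)/eqP <-.
Qed.

(** The [i]-th power is generated in the single degree [n * i], so multiplying it by the maximal
    ideal means exactly leaving this degree. *)
Lemma max_cover_pow i m : mon_pow C i m ->
  mon_mul (fun m => m != 0%MM) (mon_pow C i) m <-> mdeg m != (n * i)%N.
Proof.
move=> Cm; split=> [[a [b [a0 Cb ->]]]|dm].
  rewrite mdegD gtn_eqF // -addn1 addnC leq_add ?cover_pow_deg //.
  by rewrite lt0n mdeg_eq0.
have [a [b [em Cb db]]] := cover_pow_decomp Cm.
exists a, b; split=> //; apply: contraNneq dm => a0.
by rewrite em a0 add0m db.
Qed.

End Whiskering.

(** * Passage to lowest-order coefficients *)

Lemma coefM_low (A : nzRingType) (p q : {poly A}) a b :
  (forall l, (l < a)%N -> p`_l = 0) -> (forall l, (l < b)%N -> q`_l = 0) ->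
  (p * q)`_(a + b) = p`_a * q`_b.
Proof.
move=> pa qb; have lt : (a < (a + b).+1)%N by rewrite ltnS leq_addr.
rewrite coefM (bigD1 (Ordinal lt)) //= addKn big1 ?addr0 // => l.
rewrite -val_eqE /= neq_ltn => /orP[/pa ->|al]; first by rewrite mul0r.
by rewrite qb ?mulr0 //; have := ltn_ord l; lia.
Qed.

Section InitialForms.
Variables (A B : comNzRingType) (phi : {rmorphism A -> {poly B}}) (d : nat).

(** Intended for [p] whose coefficient of index [i] has order at least [d * i] under [phi], as in
    [order_ge]; only the part of exactly that order is kept. *)
Definition initial_form (p : {poly A}) : {poly B} :=
  \poly_(i < size p) (phi p`_i)`_(d * i).

Lemma initial_form_coef p i : (initial_form p)`_i = (phi p`_i)`_(d * i).
Proof.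
rewrite coef_poly; case: ltnP => // le.
by rewrite [p`_i]nth_default // rmorph0 coef0.
Qed.

Lemma initial_form_zmod : zmod_morphism initial_form.
Proof.
by move=> p q; apply/polyP => i; rewrite coefB !initial_form_coef coefB rmorphB coefB.
Qed.

Lemma initial_formC a b : phi a = b%:P -> initial_form a%:P = b%:P.
Proof.
move=> e; apply/polyP => i; rewrite initial_form_coef !coefC; case: eqP => [->|_].
  by rewrite muln0 e coefC.
by rewrite rmorph0 coef0.
Qed.

Lemma initial_form1 : initial_form 1 = 1.
Proof. by apply: initial_formC; rewrite rmorph1. Qed.

Lemma initial_formZX a : initial_form (a *: 'X) = (phi a)`_d *: 'X.
Proof.
apply/polyP => i; rewrite initial_form_coef !coefZ !coefX; case: eqP => [->|_].
  by rewrite !mulr1 muln1.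
by rewrite !mulr0 rmorph0 coef0.
Qed.

Definition order_ge (p : {poly A}) : Prop :=
  forall i l, (l < d * i)%N -> (phi p`_i)`_l = 0.

(** The orders [d * j] and [d * (i - j)] of two factors add up to [d * i], so in each product only
    the two lowest coefficients contribute. *)
Lemma initial_formM p q : order_ge p -> order_ge q ->
  initial_form (p * q) = initial_form p * initial_form q.
Proof.
move=> op oq; apply/polyP => i; rewrite coefM initial_form_coef coefM rmorph_sum coef_sum.
apply: eq_bigr => j _; rewrite !initial_form_coef rmorphM.
have -> : (d * i = d * j + d * (i - j))%N by rewrite -mulnDr subnKC // -ltnS.
by rewrite coefM_low //; [apply: op | apply: oq].
Qed.

End InitialForms.

(** * Embedding of the fiber cone into a polynomial ring; analytic spread *)

Section FiberConeEmbedding.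
Local Open Scope quotient_scope.
Variables (k : fieldType) (n : nat) (G : sgraph n).
Local Notation R := {mpoly k[n + n]}.
Local Notation W := {mpoly k[n]}.
Local Notation mon := 'X_{1..n + n}.
Let C := cover_mon (whiskering G).
Let I := cover_ideal k (whiskering G).

Let I_mon i : ideal_exp I i =i mon_ideal (mon_pow C i).
Proof. exact/ideal_exp_mon/cover_ideal_mon. Qed.

Definition y_part (m : mon) : 'X_{1..n} := [multinom m (rshift n j) | j < n].

(* x_j |-> s and y_j |-> z_j s, where s is the variable of the univariate
   polynomial ring; the exponent of s records the degree. *)
Definition theta (p : R) : {poly W} :=
  mmap (polyC \o @mpolyC n k)
    (fun v => match split v with inl _ => 'X | inr j => ('X_j)%:P * 'X end) p.

HB.instance Definition _ := GRing.RMorphism.copy theta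
  (mmap (polyC \o @mpolyC n k)
    (fun v => match split v with inl _ => 'X | inr j => ('X_j)%:P * 'X end)).

Lemma thetaX m : theta 'X_[m] = 'X_[y_part m] *: 'X^(mdeg m).
Proof.
rewrite /theta mmapX /mmap1 big_split_ord /= mdeg_split big_split /= exprD.
under eq_bigr => j _ do rewrite (unsplitK (inl j)).
under [X in _ * X]eq_bigr => j _ do rewrite (unsplitK (inr j)) exprMn -rmorphXn.
rewrite big_split /= !prodrXr -rmorph_prod /= mulrCA -mul_polyC; congr (_%:P * _).
by rewrite [RHS]mpolyXE_id; apply: eq_bigr => j _; rewrite mnmE.
Qed.

Lemma theta_coef p l :
  (theta p)`_l = \sum_(m <- msupp p | mdeg m == l) p@_m *: 'X_[y_part m].
Proof.
rewrite [p in LHS]mpolyE rmorph_sum /= coef_sum [RHS]big_mkcond /=.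
apply: eq_bigr => m _; rewrite -mul_mpolyC rmorphM /= [theta _%:MP]mmapC /= thetaX.
by rewrite coefCM coefZ coefXn eq_sym mulr_natr mul_mpolyC; case: eqP;
   rewrite ?mulr1n ?mulr0n ?scaler0.
Qed.

Lemma theta_coef_low i p l : p \in ideal_exp I i -> (l < n * i)%N -> (theta p)`_l = 0.
Proof.
rewrite I_mon => /asboolP Cp lt; rewrite theta_coef big_seq_cond big1 // => m.
by case/andP=> /Cp /cover_pow_deg + /eqP ml; rewrite ml leqNgt lt.
Qed.

Lemma theta_coef_inj i p : p \in ideal_exp I i ->
  (theta p)`_(n * i) = 0 -> forall m, mdeg m = (n * i)%N -> p@_m = 0.
Proof.
rewrite I_mon => /asboolP Cp + m dm; rewrite theta_coef.
have [mp|] := boolP (m \in msupp p); last by rewrite mcoeff_msupp negbK => /eqP.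
move/(congr1 (mcoeff (y_part m))); rewrite mcoeff0 raddf_sum /= => H; rewrite -[RHS]H.
rewrite big_mkcond (bigD1_seq m) ?msupp_uniq //= dm eqxx mcoeffZ mcoeffX eqxx mulr1.
rewrite big_seq_cond big1 ?addr0 // => m' /andP[mp' ne].
case: eqP => // dm'; rewrite mcoeffZ mcoeffX.
case: eqP => [e|]; last by rewrite mulr0.
(* The y exponents agree by [e], and the x exponents are their complements to [i] by
   [cover_pow_eq]. *)
case/negP: ne; apply/eqP/mnmP => v; rewrite -[v]splitK; case: (split v) => j; rewrite /unsplit.
  have := cover_pow_eq j (Cp _ mp) dm; have := cover_pow_eq j (Cp _ mp') dm'.
  have /mnmP/(_ j) := e; rewrite !mnmE => -> <-; lia.
by have /mnmP/(_ j) := e; rewrite !mnmE.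
Qed.

(** A ring morphism on the Rees algebra with kernel [fiber_ideal], so that it factors injectively
    through the fiber cone. *)
Definition initial_part (a : rees_algebra I) : {poly W} := initial_form theta n (val a).

Lemma rees_coef (a : rees_algebra I) i : (val a)`_i \in ideal_exp I i.
Proof. by have /asboolP := valP a. Qed.

Lemma rees_order_ge (a : rees_algebra I) : order_ge theta n (val a).
Proof. by move=> i l; apply: theta_coef_low; apply: rees_coef. Qed.

Lemma initial_part_zmod : zmod_morphism initial_part.
Proof.
move=> a b; have e : val (a - b) = val a - val b by exact: raddfB.
rewrite /initial_part e; exact: initial_form_zmod.
Qed.

Lemma initial_part_monoid : monoid_morphism initial_part.
Proof.
split=> [|a b]; first exact: initial_form1.
exact: initial_formM (rees_order_ge a) (rees_order_ge b).
Qed.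

HB.instance Definition _ := GRing.isZmodMorphism.Build _ _ initial_part initial_part_zmod.
HB.instance Definition _ := GRing.isMonoidMorphism.Build _ _ initial_part initial_part_monoid.

(* theta is injective on the monomials of degree n * i in I^i, since the exponents
   of x_j and y_j in such a monomial add up to i. *)
Lemma max_ideal_exp i p : p \in ideal_exp I i ->
  (p \in ideal_mul (@homog_max_ideal k (n + n)) (ideal_exp I i)) <->
  (theta p)`_(n * i) = 0.
Proof.
move=> Ip; have Cp := Ip; rewrite I_mon in Cp; move/asboolP: Cp => Cp.
rewrite (ideal_mul_mon (@mon_pow_up _ _ i) (@homog_max_ideal_mon k _) (I_mon i)).
split=> [/asboolP H|H].
  rewrite theta_coef big_seq_cond big1 // => m /andP[mp]; have := Cp m mp.
  by move=> /max_cover_pow[+ _] => /(_ (H m mp))/negbTE ->.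
apply/asboolP => m mp; apply/(max_cover_pow (Cp m mp)).
by apply: contraL mp => /eqP dm; rewrite mcoeff_msupp (theta_coef_inj Ip H dm) eqxx.
Qed.

Lemma fiber_idealE (a : rees_algebra I) : (a \in @fiber_ideal _ _ I) = (initial_part a == 0).
Proof.
have coefE i : (initial_part a)`_i = (theta (val a)`_i)`_(n * i).
  exact: initial_form_coef.
apply/asboolP/eqP => [H|H i].
  apply/polyP => i; rewrite coefE coef0; apply/max_ideal_exp => //; exact: rees_coef.
by apply/(max_ideal_exp (rees_coef a i)); rewrite -coefE H coef0.
Qed.

Definition fiber_embed (a : fiber_cone I) : {mpoly k[n.+1]} :=
  last_var (initial_part (repr a)).

(** Independence of the representative: two of them differ by an element of the fiber ideal, on
    which [initial_part] vanishes. *)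
Lemma fiber_embed_pi a : fiber_embed (\pi_(fiber_cone I) a) = last_var (initial_part a).
Proof.
rewrite /fiber_embed; apply: (congr1 (@last_var k n)).
move: (repr _) (reprK (\pi_(fiber_cone I) a)) => r er.
apply/eqP; rewrite -subr_eq0.
have <- := raddfB initial_part r a.
by rewrite -fiber_idealE Quotient.idealrBE; apply/eqP.
Qed.

Lemma fiber_embed_zmod : zmod_morphism fiber_embed.
Proof.
move=> a b; rewrite -[a]reprK -[b]reprK -rmorphB !fiber_embed_pi.
by rewrite !rmorphB.
Qed.

Lemma fiber_embed_monoid : monoid_morphism fiber_embed.
Proof.
split=> [|a b]; first by rewrite -[1](rmorph1 (\pi_(fiber_cone I))) fiber_embed_pi !rmorph1.
rewrite -[a]reprK -[b]reprK -rmorphM !fiber_embed_pi.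
by rewrite !rmorphM.
Qed.

HB.instance Definition _ := GRing.isZmodMorphism.Build _ _ fiber_embed fiber_embed_zmod.
HB.instance Definition _ := GRing.isMonoidMorphism.Build _ _ fiber_embed fiber_embed_monoid.

Lemma fiber_embed_inj : injective fiber_embed.
Proof.
apply: raddf_inj => a; rewrite -[a]reprK; move: (repr a) => r fr.
have {fr} : last_var (initial_part r) = last_var 0.
  by rewrite rmorph0 -fiber_embed_pi.
move=> /(can_inj (@last_varK k n))/eqP; rewrite -fiber_idealE => Fr.
apply: etrans (rmorph0 (\pi_(fiber_cone I))); apply/eqP.
by rewrite -Quotient.idealrBE subr0.
Qed.

Lemma const_in_rees (a : k) : (a%:MP)%:P \in in_rees I.
Proof.
apply/asboolP => i; rewrite coefC; case: eqP => [->//|_].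
by have [] := ideal_exp_closed I i.
Qed.

Definition fiber_const (a : k) : fiber_cone I := \pi_(fiber_cone I) (Rees (const_in_rees a)).

Lemma fiber_embed_const a : fiber_embed (fiber_const a) = a%:MP.
Proof.
rewrite fiber_embed_pi.
have -> : initial_part (Rees (const_in_rees a)) = (a%:MP)%:P.
  by apply: initial_formC; exact: mmapC.
by rewrite last_varC mwidenC.
Qed.

Lemma cover_in_rees A : A \in independents G -> 'X_[cover_of A] *: 'X \in in_rees I.
Proof.
move=> IA; apply/asboolP => i; rewrite coefZ coefX I_mon.
case: eqP => [->|_]; last by rewrite mulr0 mon_ideal0.
rewrite mulr1; apply/mon_idealX; exists (cover_of A), 0%MM; rewrite addm0; split=> //.
exact: cover_of_cover.
Qed.

Lemma fiber_embed_cover A (IA : A \in independents G) :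
  fiber_embed (\pi_(fiber_cone I) (Rees (cover_in_rees IA))) =
  'X_[mnmwiden (y_part (cover_of A)) + U_(ord_max)].
Proof.
rewrite fiber_embed_pi.
have -> : initial_part (Rees (cover_in_rees IA)) = 'X_[y_part (cover_of A)] *: 'X.
  apply: etrans (initial_formZX theta n 'X_[cover_of A]) _; congr (_ *: 'X).
  by rewrite /= thetaX mdeg_cover_of coefZ coefXn eqxx mulr1.
by rewrite -mul_polyC rmorphM /= last_varC last_varX mwidenX mpolyXD.
Qed.

Lemma independents0 : set0 \in independents G.
Proof. by apply/independentsP => i j; rewrite inE. Qed.

Lemma independents1 i : [set i] \in independents G.
Proof. by apply/independentsP => u v; rewrite !inE => /eqP -> /eqP ->; rewrite adj_irr. Qed.

(** The set [[set j]] gives z_j T and the empty set gives T. As T is the last variable, the first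
    variable of z_j T is z_j, which is what [Phi_X] asks for. *)
Lemma analytic_spread_whiskering : analytic_spread I n.+1.
Proof.
apply: (krull_dim_subalgebra fiber_embed_const fiber_embed_inj) => i.
case: (unliftP ord_max i) => [j ->|->].
  have -> : lift ord_max j = widen_ord (leqnSn n) j.
    by apply: val_inj; rewrite /= /bump leqNgt ltn_ord.
  exists (\pi_(fiber_cone I) (Rees (cover_in_rees (independents1 j)))).
  eexists; split; first exact: fiber_embed_cover.
    by rewrite mnmDE mnmwiden_widen mnmE cover_of_y set11.
  move=> i' lt.
  have i'n : (i' < n)%N := ltn_trans lt (ltn_ord j).
  have -> : i' = widen_ord (leqnSn n) (Ordinal i'n) by apply: val_inj.
  rewrite mnmDE mnmwiden_widen mnmE cover_of_y inE mnm1E -!val_eqE /=.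
  by rewrite ltn_eqF // gtn_eqF.
exists (\pi_(fiber_cone I) (Rees (cover_in_rees independents0))).
eexists; split; first exact: fiber_embed_cover.
  by rewrite mnmDE mnm1E eqxx addn1.
move=> i' lt; have -> : i' = widen_ord (leqnSn n) (Ordinal lt) by apply: val_inj.
by rewrite mnmDE mnmwiden_widen mnmE cover_of_y inE mnm1E -!val_eqE /= gtn_eqF.
Qed.

End FiberConeEmbedding.

(** * Freiman whiskerings *)

Section AlmostComplete.
Variables (n : nat) (G : sgraph n).

Lemma independents_down (A B : {set 'I_n}) :
  B \subset A -> A \in independents G -> B \in independents G.
Proof.
move=> /subsetP BA /independentsP indA; apply/independentsP => i j /BA iA /BA jA.
exact: indA.
Qed.

Let nonadj i j := (i != j) && ~~ G i j.

Let nonadj_sym i j : nonadj i j = nonadj j i.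
Proof. by rewrite /nonadj eq_sym adj_sym. Qed.

Let nonadj_pair i j : nonadj i j -> [set i; j] \in independents G.
Proof.
move=> /andP[_ nG]; apply/independentsP => u v; rewrite !inE.
by case/pred2P=> -> /pred2P[] ->; rewrite ?adj_irr // adj_sym.
Qed.

(** Pairwise meeting edges form a star or a triangle, and a triangle of non-edges would be an
    independent set of size 3. *)
Let nonadj_center : (0 < n)%N ->
  (forall U, U \in independents G -> #|U| <= 2)%N ->
  (forall i j k l, nonadj i j -> nonadj k l -> [|| i == k, i == l, j == k | j == l]) ->
  exists v, forall i j, nonadj i j -> (i == v) || (j == v).
Proof.
move=> n0 le2 meet.
have [[a b] /= ab|none] := pickP (fun p : 'I_n * 'I_n => nonadj p.1 p.2); last first.
  by exists (Ordinal n0) => i j ij; have := none (i, j); rewrite /= ij.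
(* Either [u] is a center, or some non-edge at [v] avoids [u]. Used at both ends of the non-edge
   [a], [b], the second case gives non-edges [b], [c] and [a], [d], which can meet only in
   [c = d]. *)
have other u v : nonadj u v -> (forall i j, nonadj i j -> (i == u) || (j == u)) \/
    exists2 c, nonadj v c & c != u.
  move=> uv.
  have [/existsP[c /andP[vc cu]]|/existsPn none] := boolP [exists c, nonadj v c && (c != u)].
    by right; exists c.
  left=> i j ij; apply/norP => -[iu ju].
  have := meet _ _ _ _ uv ij; rewrite ![u == _]eq_sym (negbTE iu) (negbTE ju) /=.
  case/orP=> /eqP e; first by have := none j; rewrite e ij ju.
  by have := none i; rewrite e nonadj_sym ij iu.
have [?|[c bc ca]] := other a b ab; first by exists a.
have [?|[d ad db]] := other b a (etrans (nonadj_sym _ _) ab); first by exists b.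
have ba : b != a by case/andP: ab; rewrite eq_sym.
have := meet _ _ _ _ bc ad; rewrite (negbTE ba) (negbTE ca) eq_sym (negbTE db) /= => /eqP cd.
rewrite -{d db}cd in ad.
have : a |: [set b; c] \in independents G.
  case/andP: ab => _ ab; case/andP: bc => _ bc; case/andP: ad => _ ac.
  apply/independentsP => i j; rewrite !inE => /or3P[]/eqP-> /or3P[]/eqP->;
    by rewrite ?adj_irr // adj_sym.
move/le2; case/andP: bc => bc _; case/andP: ad => ac _; case/andP: ab => ab' _.
by rewrite cardsU1 cards2 bc !inE negb_or ab' ac.
Qed.

Lemma face_sums_almost_complete :
  (n.+1 * #|independents G| = #|face_sums (independents G)| + 'C(n.+1, 2))%N <->
  almost_complete G.
Proof.
have S0 := independents0 G; have S1 := independents1 G; have Sd := independents_down.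
have cardT := card_ord n.
(* For [n] equal to 0 there is no vertex to serve as a center; both sides hold, the equation reading
   1 = 1 + 0. *)
case: (posnP n) => [n0|npos].
  have e0 (A : {set 'I_n}) : A = set0.
    by apply/setP => i; have := ltn_ord i; rewrite [X in (_ < X)%N]n0.
  split=> _; first by exists set0; split=> [|i j]; rewrite ?inE // cards0 [in RHS]n0.
  have -> : independents G = [set set0] by apply/setP => A; rewrite (e0 A) S0 inE eqxx.
  have -> : face_sums [set (set0 : {set 'I_n})] = [set (set0, set0)].
    apply/setP => -[A B]; rewrite (e0 A) (e0 B) inE eqxx; apply/imset2P.
    by exists set0 set0; rewrite ?inE // setU0 setI0.
  by rewrite !cards1 [in LHS]n0 [in RHS]n0.
split=> [eqS|[K [Kn Kc]]].
  (* Equality excludes the strict inequalities, hence faces of size 3 and disjoint non-edges; the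
     complement of the resulting center is a clique. *)
  have no : ~ (#|'I_n|.+1 * #|independents G| <
      #|face_sums (independents G)| + 'C(#|'I_n|.+1, 2))%N.
    by rewrite cardT eqS ltnn.
  have [//|U SU|i j k l ij kl|v vP] := nonadj_center.
  - rewrite leqNgt; apply/negP => U3; apply: no.
    exact: (face_sums_big_face Sd S0 S1 SU).
  - apply: contra_notT no; rewrite !negb_or => /and4P[ik il jk jl].
    apply: (face_sums_disjoint_edges Sd S0 S1 (nonadj_pair ij) (nonadj_pair kl)).
    + by case/andP: ij; rewrite cards2 => ->.
    + by case/andP: kl; rewrite cards2 => ->.
    + apply/pred0P => x; rewrite !inE; apply/negP => /andP[/pred2P[]-> /pred2P[]e];
        by move: ik il jk jl; rewrite e eqxx.
  exists [set~ v]; split; first by rewrite cardsC1 cardT.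
  move=> i j; rewrite !inE => iv jv ij; apply: contraNT iv => nG.
  by have := vP i j; rewrite /nonadj ij nG (negbTE jv) orbF; apply.
have /cards1P[v Kv] : #|~: K| == 1%N.
  by have := cardsC K; rewrite Kn cardT -[n in RHS](prednK npos) -addn1 => /addnI ->.
suff: forall A, A \in independents G -> (#|A :\ v| <= 1)%N.
  by move=> /(face_sums_star Sd S0 S1); rewrite cardT.
move=> A /independentsP indA.
rewrite leqNgt; apply/negP => /card_gt1P[i [j []]].
rewrite !inE => /andP[iv iA] /andP[jv jA] ij.
have inK x : x != v -> x \in K by rewrite -[x \in K]negbK -in_setC Kv inE.
by have := indA i j iA jA; rewrite Kc ?inK.
Qed.

End AlmostComplete.

(** * Minimal generators of the cover ideal and of its square *)

Section Generators.
Variables (k : fieldType) (n : nat) (G : sgraph n).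
Local Notation mon := 'X_{1..n + n}.
Let C := cover_mon (whiskering G).
Let I := cover_ideal k (whiskering G).

Lemma cover_of_inj : injective (@cover_of n).
Proof.
move=> A B /mnmP e; apply/setP => i; have := e (rshift n i); rewrite !cover_of_y.
by do 2!case: (_ \in _).
Qed.

Lemma whiskering_num_gens : min_num_gens I #|independents G|.
Proof.
rewrite cardE -(size_map (@cover_of n)).
apply: (@min_num_gens_mon k _ C I n).
- exact: cover_mon_up.
- exact: cover_ideal_mon.
- by rewrite (map_inj_uniq cover_of_inj) enum_uniq.
- move=> _ /mapP[A + ->]; rewrite mem_enum => IA.
  by split; [exact: cover_of_cover | exact: mdeg_cover_of].
- move=> m /cover_decomp[a [A [IA ->]]]; exists a, (cover_of A); split=> //.
  by rewrite map_f // mem_enum.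
Qed.

(** On a union and an intersection this is the exponent of the product of two covers by [sum_ofUI],
    although [cover_of] of the union alone need not be a cover. *)
Definition sum_of (P : {set 'I_n} * {set 'I_n}) : mon := (cover_of P.1 + cover_of P.2)%MM.

Lemma sum_ofUI A B : sum_of (A :|: B, A :&: B) = (cover_of A + cover_of B)%MM.
Proof.
apply/mnmP => v; rewrite -[v]splitK !mnmDE; case: (split v) => i; rewrite /unsplit /=.
  by rewrite !cover_of_x !inE; case: (i \in A); case: (i \in B).
by rewrite !cover_of_y !inE; case: (i \in A); case: (i \in B).
Qed.

(** The exponent of y_i is positive exactly on the union and equal to 2 exactly on the
    intersection. *)
Lemma sum_of_inj : {in face_sums (independents G) &, injective sum_of}.
Proof.
move=> _ _ /imset2P[A B _ _ ->] /imset2P[A' B' _ _ ->] /mnmP e.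
have {}e i := e (rshift n i).
by congr (_, _); apply/setP => i; have := e i; rewrite !mnmDE !cover_of_y !inE;
   case: (i \in A) (i \in B) (i \in A') (i \in B') => -[] [] [].
Qed.

Lemma whiskering_num_gens2 : min_num_gens (ideal_exp I 2) #|face_sums (independents G)|.
Proof.
rewrite cardE -(size_map sum_of).
apply: (@min_num_gens_mon k _ (mon_pow C 2) _ (n * 2)).
- exact: mon_pow_up.
- exact/ideal_exp_mon/cover_ideal_mon.
- rewrite map_inj_in_uniq ?enum_uniq // => p q; rewrite !mem_enum; exact: sum_of_inj.
- move=> _ /mapP[P + ->]; rewrite mem_enum => /imset2P[A B IA IB ->].
  rewrite sum_ofUI muln2 -addnn; split; last by rewrite mdegD !mdeg_cover_of.
  exists (cover_of A), (cover_of B); split=> //; first exact: cover_of_cover.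
  (* The square ends with a factor from the unit ideal, for which the exponent 0 is taken. *)
  exists (cover_of B), 0%MM; rewrite addm0; split=> //; exact: cover_of_cover.
- move=> _ [_ [_ [/cover_decomp[a [A [IA ->]]] [_ [c [/cover_decomp[b [B [IB ->]]] _ ->]]] ->]]].
  exists (a + (b + c))%MM, (sum_of (A :|: B, A :&: B)); split.
    by rewrite map_f // mem_enum; apply/imset2P; exists A B.
  rewrite sum_ofUI; apply/mnmP => v; rewrite !mnmDE; lia.
Qed.

Lemma whiskering_quasi_equigenerated : quasi_equigenerated I.
Proof.
split; first exact: (mon_ideal_monomial (@cover_mon_up _ _) (@cover_ideal_mon k _ _)).
(* Unit weights suffice, since every minimal generator has degree [n]. *)
exists (fun=> 1%N); split=> // m m'.
have deg x : min_mon_gen I x -> (\sum_(i < n + n) 1 * x i)%N = n.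
  rewrite /min_mon_gen cover_ideal_mon => -[/mon_idealX/cover_decomp[a [A [IA ->]]] min].
  rewrite -(min (cover_of A)) ?lem_addl //; last first.
    by rewrite cover_ideal_mon; apply/mon_idealX/cover_of_cover.
  by under eq_bigr do rewrite mul1n; rewrite -mdegE mdeg_cover_of.
by move=> /deg -> /deg ->.
Qed.

End Generators.

Theorem theorem5p9 (k : fieldType) (n : nat) (G : sgraph n) :
  freiman (cover_ideal k (whiskering G)) <-> almost_complete G.
Proof.
rewrite -face_sums_almost_complete.
have mu := whiskering_num_gens k G; have mu2 := whiskering_num_gens2 k G.
have l := analytic_spread_whiskering k G.
(* The subtraction is taken in the integers, without truncation, so it can be moved to the other
   side. *)
have eqE (a b c : nat) : a%:Z = (b * c)%N%:Z - 'C(b, 2)%:Z <-> (b * c = a + 'C(b, 2))%N.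
  by split; lia.
split=> [[_ [m [m2 [d [Hm Hm2 Hd]]]]]|E].
  rewrite (min_num_gens_inj Hm mu) (min_num_gens_inj Hm2 mu2) (krull_dim_inj Hd l).
  by rewrite -PoszM => /eqE.
split; first exact: whiskering_quasi_equigenerated.
exists #|independents G|, #|face_sums (independents G)|, n.+1; split=> //.
by rewrite -PoszM; apply/eqE.
Qed.
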